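(* Let $\mu$ be a non-trivial $d\times d$ matrix measure on $\mathbb{T}$ with Schur function $f$, Verblunsky coefficients $(\alpha_i)_{i\ge0}$, orthonormal polynomials $\varphi_i^L,\varphi_i^R$, iterates $f_i$ and inverse iterates $b_i$. For integers $0\le j\le k$ let $\nu_{[j,k]}$ and $\hat\nu_{[j,k]}$ be the $(k-j+1)d\times(k-j+1)d$ matrix measures with $d\times d$ blocks $(\nu_{[j,k]})_{r,s}=(\varphi_r^R)^\dagger\,d\mu\,\varphi_s^R$ and $(\hat\nu_{[j,k]})_{r,s}=\varphi_r^L\,d\mu\,(\varphi_s^L)^\dagger$, $j\le r,s\le k$, with Schur functions $h_{[j,k]}$ and $\hat h_{[j,k]}$. Then $$h_{[j,k]}=(\mathbb{1}_{k-j}\oplus f_k)\,\mathcal{H}_{(j,k)}^\dagger\,(b_j\oplus\mathbb{1}_{k-j}),\qquad \hat h_{[j,k]}=(b_j\oplus\mathbb{1}_{k-j})\,\hat{\mathcal{H}}_{(j,k)}^\dagger\,(\mathbb{1}_{k-j}\oplus f_k).$$ (Equivalently, $h_{[j,k]}$ and $\hat h_{[j,k]}$ result from substituting $-\alpha_{j-1}^\dagger\to b_j$ and $\alpha_k\to f_k$ in $\mathcal{H}_{[j,k]}^\dagger$, $\hat{\mathcal{H}}_{[j,k]}^\dagger$, the adjoints of the principal $d$-block submatrices on blocks $j,\dots,k$ of the block Hessenberg matrices $\mathcal{H}$, $\hat{\mathcal{H}}$ of $\mu$.)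
   Context: A $d\times d$ matrix measure on $\mathbb{T}$ is a positive semidefinite matrix-valued Borel measure with $\mu(\mathbb{T})=\mathbb{1}$; its Schur function is $f=z^{-1}(F-\mathbb{1})(F+\mathbb{1})^{-1}$, $F(z)=\int\frac{t+z}{t-z}d\mu(t)$. Matrix Schur algorithm: $g_0=g$, $\beta_m=g_m(0)$, $g_{m+1}=z^{-1}(\rho_m^R)^{-1}(g_m-\beta_m)(\mathbb{1}-\beta_m^\dagger g_m)^{-1}\rho_m^L$ with $\rho^L=(\mathbb{1}-\beta^\dagger\beta)^{1/2}$, $\rho^R=(\mathbb{1}-\beta\beta^\dagger)^{1/2}$; $(\beta_m)$ are the Schur parameters, which determine a Schur function uniquely (a finite list ending in $\mathbb{1}$ means the algorithm terminates with $g\equiv\mathbb{1}$). $\mu$ is non-trivial if $\int\phi^\dagger d\mu\,\phi\ne0$ for all nonzero vector polynomials $\phi$; then the Schur parameters $\alpha_i$ of $f$ are infinitely many with $\|\alpha_i\|<1$ (Verblunsky coefficients). $f_i$ is the Schur function with parameters $(\alpha_i,\alpha_{i+1},\dots)$; $b_i$ is the Schur function with parameters $(-\alpha_{i-1}^\dagger,\dots,-\alpha_0^\dagger,\mathbb{1})$ ($b_0\equiv\mathbb{1}$). Orthonormal polynomials $\varphi_i^L,\varphi_i^R$: Gram–Schmidt of $\mathbb{1},z\mathbb{1},\dots$ w.r.t. $\langle\!\langle g|h\rangle\!\rangle_L=\int h\,d\mu\,g^\dagger$, resp. $\langle\!\langle g|h\rangle\!\rangle_R=\int g^\dagger d\mu\,h$,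 with $\varphi_0=\mathbb{1}$ and leading coefficients satisfying $\kappa_{i+1}^L(\kappa_i^L)^{-1}>0$, $(\kappa_i^R)^{-1}\kappa_{i+1}^R>0$. With $\Theta(\beta)=\begin{pmatrix}\beta^\dagger&\rho^L\\ \rho^R&-\beta\end{pmatrix}$, for $(\beta_0,\dots,\beta_{M-1})$ let $\Theta_i^{(M)}=\mathbb{1}_i\oplus\Theta(\beta_i)\oplus\mathbb{1}_{M-i-1}$ (order $(M+1)d$) and define the finite unitary block Hessenberg matrices $\mathcal{H}_M(\beta_0,\dots,\beta_{M-1})=\Theta_0^{(M)}\Theta_1^{(M)}\cdots\Theta_{M-1}^{(M)}$, $\hat{\mathcal{H}}_M(\beta_0,\dots,\beta_{M-1})=\Theta_{M-1}^{(M)}\cdots\Theta_1^{(M)}\Theta_0^{(M)}$ ($\mathcal{H}_0=\hat{\mathcal H}_0=\mathbb{1}$). Then $\mathcal{H}_{(j,k)}=\mathcal{H}_{k-j}(\alpha_j,\dots,\alpha_{k-1})$ and $\hat{\mathcal{H}}_{(j,k)}=\hat{\mathcal{H}}_{k-j}(\alpha_j,\dots,\alpha_{k-1})$. The semi-infinite block Hessenberg matrices are the strong limits $\mathcal{H}=\lim_M\Theta_0\Theta_1\cdots\Theta_M$, $\hat{\mathcal{H}}=\lim_M\Theta_M\cdots\Theta_0$ built from $(\alpha_i)$. $\mathbb{1}_m$ is the $md\times md$ identity. *)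

(* Defs.v *)
From HB Require Import structures.
From mathcomp Require Import all_boot all_order all_algebra.
From mathcomp Require Import all_classical all_reals all_analysis.
From mathcomp Require Import complex.
Import Order.TTheory GRing.Theory Num.Theory.
Import numFieldTopology.Exports numFieldNormedType.Exports.

Set Implicit Arguments.
Unset Strict Implicit.
Unset Printing Implicit Defensive.

Local Open Scope classical_set_scope.
Local Open Scope ring_scope.

(* The complex numbers over a real type R, seen as a numClosedFieldType
   (this gives them their canonical topology / normed structure). *)
Definition C (R : realType) : numClosedFieldType := R[i].

Section MatrixMeasures.
Variable R : realType.
Local Notation C := (C R).

Definition adj m n (A : 'M[C]_(m, n)) : 'M[C]_(n, m) := map_mx Num.conj A^T.

Definition psd n (A : 'M[C]_n) : Prop :=
  forall v : 'cV[C]_n, 0 <= (adj v *m A *m v) 0 0.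
Definition posdef n (A : 'M[C]_n) : Prop :=
  forall v : 'cV[C]_n, v != 0 -> 0 < (adj v *m A *m v) 0 0.

Definition sqrtm n (A : 'M[C]_n) : 'M[C]_n :=
  xget 0 [set B | psd B /\ B *m B = A].

Variable d : nat.   (* matrices are (d.+1) x (d.+1), i.e. any size >= 1 *)
Local Notation Md := 'M[C]_d.+1.

Definition rhoL (b : Md) : Md := sqrtm (1%:M - adj b *m b).
Definition rhoR (b : Md) : Md := sqrtm (1%:M - b *m adj b).

(* one step of the matrix Schur algorithm:
   g_{m+1} = z^-1 (rho^R)^-1 (g - b)(1 - b^dag g)^-1 rho^L,  b = g(0);
   the value at z = 0 is the (removable-singularity) limit. *)
Definition schur_step (g : C -> Md) : C -> Md :=
  let b := g 0 in
  let q := fun z : C =>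
    z^-1 *: (invmx (rhoR b) *m (g z - b) *m invmx (1%:M - adj b *m g z) *m rhoL b) in
  fun z => if z == 0 then \matrix_(a, c) lim ((fun w => q w a c) @ (0 : C)^')
           else q z.

Definition schur_iter (g : C -> Md) (m : nat) : C -> Md := iter m schur_step g.

Definition is_schur (g : C -> Md) : Prop :=
  (forall z : C, `|z| < 1 -> forall a c, derivable (fun w : C => g w a c) z 1) /\
  (forall z : C, `|z| < 1 -> psd (1%:M - adj (g z) *m g z)).

(* g has the finite list of Schur parameters s (last one being 1: the
   algorithm terminates with g_{size s - 1} = 1) *)
Definition has_fin_schur_params (g : C -> Md) (s : seq Md) : Prop :=
  (forall m, (m < size s)%N -> schur_iter g m 0 = nth 0 s m) /\
  (forall z : C, `|z| < 1 -> schur_iter g (size s).-1 z = 1%:M).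

Definition expi (t : R) : C := (cos t +i* sin t)%C.

Definition cint (mu : {measure set R -> \bar R}) (f : R -> C) : C :=
  ((Rintegral mu setT (fun t => complex.Re (f t))) +i*
   (Rintegral mu setT (fun t => complex.Im (f t))))%C.

Definition mint m n (mu : {measure set R -> \bar R}) (G : R -> 'M[C]_(m, n))
  : 'M[C]_(m, n) := \matrix_(a, c) cint mu (fun t => G t a c).

(* A matrix measure on T is encoded as dmu(e^{it}) = W(t) dtau(t), with tau a
   positive measure on R (angles) and W a psd density with integrable entries. *)
Definition is_matrix_measure n (mu : {measure set R -> \bar R}) (W : R -> 'M[C]_n)
  : Prop :=
  (forall t, psd (W t)) /\
  (forall a c, mu.-integrable setT (EFin \o (fun t => complex.Re (W t a c))) /\
               mu.-integrable setT (EFin \o (fun t => complex.Im (W t a c)))) /\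
  mint mu W = 1%:M.

Definition vpoly_at (s : seq 'cV[C]_d.+1) (t : R) : 'cV[C]_d.+1 :=
  \sum_(k < size s) (expi t ^+ k) *: nth 0 s k.

Definition nontrivial (mu : {measure set R -> \bar R}) (W : R -> Md) : Prop :=
  forall s : seq 'cV[C]_d.+1, has (fun c => c != 0) s ->
    mint mu (fun t => adj (vpoly_at s t) *m W t *m vpoly_at s t) != 0.

Definition mpoly_at (p : {poly Md}) (t : R) : Md := p.[(expi t)%:M].

Definition ipR mu (W : R -> Md) (g h : {poly Md}) : Md :=
  mint mu (fun t => adj (mpoly_at g t) *m W t *m mpoly_at h t).
Definition ipL mu (W : R -> Md) (g h : {poly Md}) : Md :=
  mint mu (fun t => mpoly_at h t *m W t *m adj (mpoly_at g t)).

Definition is_ONP_R mu W (phi : nat -> {poly Md}) : Prop :=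
  phi 0%N = 1 /\
  (forall i, size (phi i) = i.+1 /\ lead_coef (phi i) \in unitmx) /\
  (forall i l, ipR mu W (phi i) (phi l) = if i == l then 1%:M else 0) /\
  (forall i, posdef (invmx (lead_coef (phi i)) *m lead_coef (phi i.+1))).
Definition is_ONP_L mu W (phi : nat -> {poly Md}) : Prop :=
  phi 0%N = 1 /\
  (forall i, size (phi i) = i.+1 /\ lead_coef (phi i) \in unitmx) /\
  (forall i l, ipL mu W (phi i) (phi l) = if i == l then 1%:M else 0) /\
  (forall i, posdef (lead_coef (phi i.+1) *m invmx (lead_coef (phi i)))).

Definition blk N (F : nat -> nat -> Md) : 'M[C]_(N * d.+1) :=
  \matrix_(p, q) F (p %/ d.+1)%N (q %/ d.+1)%N (inord (p %% d.+1)) (inord (q %% d.+1)).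

(* Theta_i^{(M)} = 1_i (+) Theta(b) (+) 1_{M-i-1}, of order (M+1)d *)
Definition Theta M i (b : Md) : 'M[C]_(M.+1 * d.+1) :=
  blk M.+1 (fun r s =>
    if (r == i) && (s == i) then adj b
    else if (r == i) && (s == i.+1) then rhoL b
    else if (r == i.+1) && (s == i) then rhoR b
    else if (r == i.+1) && (s == i.+1) then - b
    else if r == s then 1%:M else 0).

Definition Hess M (b : nat -> Md) : 'M[C]_(M.+1 * d.+1) :=
  foldr (fun i A => Theta M i (b i) *m A) 1%:M (iota 0 M).
Definition Hesshat M (b : nat -> Md) : 'M[C]_(M.+1 * d.+1) :=
  foldr (fun i A => Theta M i (b i) *m A) 1%:M (rev (iota 0 M)).

(* Schur function of a matrix measure V dmu:
   f(z) = z^-1 (F(z) - 1)(F(z) + 1)^-1 with F(z) = int (t+z)/(t-z) dmu(t);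
   since mu(T) = 1, z^-1 (F(z) - 1) = int 2/(t-z) dmu(t). *)
Definition caratheodory n mu (V : R -> 'M[C]_n) (z : C) : 'M[C]_n :=
  mint mu (fun t => ((expi t + z) / (expi t - z)) *: V t).
Definition schur_fun n mu (V : R -> 'M[C]_n) (z : C) : 'M[C]_n :=
  mint mu (fun t => (2 / (expi t - z)) *: V t) *m invmx (caratheodory mu V z + 1%:M).

Definition PhiR (phi : nat -> {poly Md}) (j k : nat) (t : R)
  : 'M[C]_(d.+1, (k - j).+1 * d.+1) :=
  \matrix_(a, q) mpoly_at (phi (j + q %/ d.+1)%N) t a (inord (q %% d.+1)).
Definition PhiL (phi : nat -> {poly Md}) (j k : nat) (t : R)
  : 'M[C]_((k - j).+1 * d.+1, d.+1) :=
  \matrix_(p, c) mpoly_at (phi (j + p %/ d.+1)%N) t (inord (p %% d.+1)) c.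

End MatrixMeasures.

(* Main.v *)
Require Import Defs.
From HB Require Import structures.
From mathcomp Require Import all_boot all_order all_algebra.
From mathcomp Require Import all_classical all_reals all_analysis.
From mathcomp Require Import complex measurable_realfun ring lra.
Import Order.TTheory GRing.Theory Num.Theory.
Import numFieldTopology.Exports numFieldNormedType.Exports.
Local Open Scope classical_set_scope.
Local Open Scope ring_scope.

(* Write t = e^{i theta}, p^* = z^n p(1/conj z)^dag for the reversed polynomial, nu = nu_[j,k]
   and h for its Schur function.

   With Y = int (t-z)^{-1} dnu and M = int t (t-z)^{-1} dnu = 1 + z Y one has h = Y M^{-1},
   and M is invertible because Re (t/(t-z)) >= 1/2.  So one must show Y = H M, where H is
   the claimed product.  The Szego recursion reads
     (t phi_n^R, phi_{n+1}^{L,*}) = (phi_n^{L,*}, phi_{n+1}^R) Theta(alpha_n),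
   so the factors Theta^dag of the Hessenberg matrix, applied one at a time, turn the integrals
   int t (phi_j^{L,*}, phi_{j+1}^R, .., phi_k^R)^dag dmu phi_s / (t-z) into
   int (phi_j^R, .., phi_{k-1}^R, t phi_k^{L,*})^dag dmu phi_s / (t-z).
   The two outer factors correct the end blocks.
   - By orthogonality, for s >= j, polynomials of degree <= j come out of the integral
     evaluated at z, so the first end only needs b_j = phi_j^L(z) (phi_j^{R,*}(z))^{-1}.
   - For s <= k, phi_s comes out, so the last end only needs f_k U_k = V_k, where
     U_k = int t (phi_k^{L,*})^dag dmu / (t-z) and V_k = int (phi_k^R)^dag dmu / (t-z).
     The recursion for (U_k, V_k) is the Schur algorithm (Geronimus), which also identifies the
     Szego coefficients with the Schur parameters.
   For b_j the Schur algorithm is inverted from its last iterate 1; a step can only break down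
   where some det phi_l^L(z) vanishes, a finite set, and b_j is continuous.
   The second formula is the first one for the transposed measure. *)

Set Implicit Arguments.
Unset Strict Implicit.
Unset Printing Implicit Defensive.

(** * Complex and matrix integrals *)

Section ComplexIntegral.
Variable R : realType.
Local Notation C := (C R).
Local Notation Re := (@complex.Re R).
Local Notation Im := (@complex.Im R).
Implicit Types (f g : R -> C) (c z : C).

Lemma ReM (x y : C) : Re (x * y) = Re x * Re y - Im x * Im y.
Proof. by case: x y => [a b] [a' b']. Qed.

Lemma ImM (x y : C) : Im (x * y) = Re x * Im y + Im x * Re y.
Proof. by case: x y => [a b] [a' b'] /=; rewrite [_ * _ + _]addrC addrC. Qed.

Lemma ReD (x y : C) : Re (x + y) = Re x + Re y.
Proof. by case: x y => [a b] [a' b']. Qed.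

Lemma ImD (x y : C) : Im (x + y) = Im x + Im y.
Proof. by case: x y => [a b] [a' b']. Qed.

Lemma ReV (x : C) : Re x^-1 = Re x / (Re x ^+ 2 + Im x ^+ 2).
Proof. by case: x. Qed.

Lemma ImV (x : C) : Im x^-1 = - Im x / (Re x ^+ 2 + Im x ^+ 2).
Proof. by case: x => a b /=; rewrite mulNr. Qed.

Lemma complex_ReIm (x y : C) : Re x = Re y -> Im x = Im y -> x = y.
Proof. by case: x y => [a b] [a' b'] /= -> ->. Qed.

Lemma Num_conjE (x : C) : Num.conj x = (x^*)%C.
Proof. by []. Qed.

Lemma Re_conj (x : C) : Re (Num.conj x) = Re x.
Proof. by rewrite Num_conjE; case: x. Qed.

Lemma Im_conj (x : C) : Im (Num.conj x) = - Im x.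
Proof. by rewrite Num_conjE; case: x. Qed.

Lemma normRe_le (x : C) : (`|Re x|%:C)%C <= `|x| :> C.
Proof. exact: normc_ge_Re. Qed.

Lemma normIm_le (x : C) : (`|Im x|%:C)%C <= `|x| :> C.
Proof.
have ni : `|('i)%C : C| = 1 by rewrite normc_def /= expr0n expr1n add0r sqrtr1.
have := normRe_le (x * ('i)%C).
by rewrite normrM ni mulr1 (ReiNIm x) normrN.
Qed.

Lemma norm_expi (t : R) : `|expi t| = 1 :> C.
Proof. by rewrite normc_def /= cos2Dsin2 sqrtr1. Qed.

Lemma expi_neq0 (t : R) : expi t != 0 :> C.
Proof. by rewrite -normr_eq0 norm_expi oner_eq0. Qed.

Lemma conj_expi (t : R) : Num.conj (expi t) = (expi t)^-1 :> C.
Proof.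
apply: (mulfI (expi_neq0 t)); rewrite -normCK norm_expi expr1n divff //.
exact: expi_neq0.
Qed.

Lemma expi_subz_neq0 (t : R) (z : C) : `|z| < 1 -> expi t - z != 0.
Proof.
by move=> z1; rewrite subr_eq0; apply: contraTneq z1 => <-; rewrite norm_expi ltxx.
Qed.

(** The multipliers that preserve integrability: continuity gives measurability, and boundedness
    gives the domination. Only the entries of [W] are known to be integrable and [mu] may be
    infinite, so integrands always keep a factor [W]. *)
Definition bcont (g : R -> C) : Prop :=
  [/\ continuous (fun t => Re (g t)), continuous (fun t => Im (g t)) &
      exists M : C, forall t, `|g t| <= M].

Lemma bcont_cst c : bcont (fun=> c).
Proof. by split; [exact: cst_continuous|exact: cst_continuous|exists `|c|]. Qed.

Lemma bcontD f g : bcont f -> bcont g -> bcont (fun t => f t + g t).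
Proof.
move=> [f1 f2 [M fM]] [g1 g2 [N gN]]; split.
- under eq_fun do rewrite ReD.
  by move=> t; apply: cvgD; [exact: f1|exact: g1].
- under eq_fun do rewrite ImD.
  by move=> t; apply: cvgD; [exact: f2|exact: g2].
- by exists (M + N) => t; apply: le_trans (ler_normD _ _) _; exact: lerD.
Qed.

Lemma bcontM f g : bcont f -> bcont g -> bcont (fun t => f t * g t).
Proof.
move=> [f1 f2 [M fM]] [g1 g2 [N gN]]; split.
- under eq_fun do rewrite ReM.
  by move=> t; apply: cvgB; apply: cvgM; [exact: f1|exact: g1|exact: f2|exact: g2].
- under eq_fun do rewrite ImM.
  by move=> t; apply: cvgD; apply: cvgM; [exact: f1|exact: g2|exact: f2|exact: g1].
- by exists (M * N) => t; rewrite normrM; apply: ler_pM.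
Qed.

Lemma bcont_conj f : bcont f -> bcont (fun t => Num.conj (f t)).
Proof.
move=> [f1 f2 [M fM]]; split.
- by under eq_fun do rewrite Re_conj.
- under eq_fun do rewrite Im_conj.
  by move=> t; apply: cvgN; exact: f2.
- by exists M => t; rewrite norm_conjC.
Qed.

Lemma bcont_sum (I : Type) (r : seq I) (F : I -> R -> C) :
  (forall i, bcont (F i)) -> bcont (fun t => \sum_(i <- r) F i t).
Proof.
move=> HF; elim: r => [|i r IH].
  by under eq_fun do rewrite big_nil; exact: bcont_cst.
by under eq_fun do rewrite big_cons; exact: bcontD.
Qed.

Lemma bcont_expi : bcont (@expi R).
Proof.
split; [exact: continuous_cos|exact: continuous_sin|].
by exists 1 => t; rewrite norm_expi.
Qed.

Lemma bcont_expiX n : bcont (fun t => (expi t) ^+ n).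
Proof.
elim: n => [|n IH]; first by under eq_fun do rewrite expr0; exact: bcont_cst.
by under eq_fun do rewrite exprS; apply: bcontM; [exact: bcont_expi|].
Qed.

Lemma bcont_inv f (m : C) : 0 < m -> (forall t, m <= `|f t|) -> bcont f ->
  bcont (fun t => (f t)^-1).
Proof.
move=> m0 fm [f1 f2 _].
have n0 t : Re (f t) ^+ 2 + Im (f t) ^+ 2 != 0.
  apply: contraTneq (lt_le_trans m0 (fm t)) => e.
  suff -> : f t = 0 by rewrite normr0 ltxx.
  move/eqP: e; rewrite paddr_eq0 ?sqr_ge0 // !sqrf_eq0 => /andP[/eqP a /eqP b].
  exact: complex_ReIm.
have c2 : continuous (fun t => (Re (f t) ^+ 2 + Im (f t) ^+ 2)^-1).
  move=> t; apply: cvgV; first exact: n0.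
  by apply: cvgD; apply: cvgM; do ?[exact: f1|exact: f2].
split.
- under eq_fun do rewrite ReV.
  by move=> t; apply: cvgM; [exact: f1|exact: c2].
- under eq_fun do rewrite ImV.
  by move=> t; apply: cvgM; [apply: cvgN; exact: f2|exact: c2].
- exists m^-1 => t; rewrite normrV ?unitfE; last first.
    by rewrite -normr_gt0 (lt_le_trans m0).
  by rewrite lef_pV2 ?posrE // (lt_le_trans m0).
Qed.

Lemma bcont_cauchy z : `|z| < 1 -> bcont (fun t => (expi t - z)^-1).
Proof.
move=> z1; apply: (@bcont_inv _ (1 - `|z|)); first by rewrite subr_gt0.
  by move=> t; rewrite -(norm_expi t); exact: lerB_dist.
by apply: bcontD; [exact: bcont_expi|exact: bcont_cst].
Qed.

Lemma bcontV_expiX n : bcont (fun t => (expi t ^+ n)^-1).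
Proof.
apply: (@bcont_inv _ 1) => //; last exact: bcont_expiX.
by move=> t; rewrite normrX norm_expi expr1n.
Qed.

Section WithMeasure.
Variable mu : {measure set R -> \bar R}.

Definition cintegrable (f : R -> C) : Prop :=
  mu.-integrable setT (EFin \o (fun t => Re (f t))) /\
  mu.-integrable setT (EFin \o (fun t => Im (f t))).

(** Norms in [C] are complex numbers, hence so is [M]; its real part is the real bound. *)
Lemma bounded_of_le (h : R -> R) (M : C) :
  (forall t, (`|h t|%:C)%C <= M) -> [bounded h x | x in setT].
Proof.
move=> hM; exists (Re M); split; first exact: num_real.
move=> x Mx t _; apply: le_trans (ltW Mx).
by have := hM t; rewrite lecE => /andP[_].
Qed.

Lemma integrableM_bcontRe g (h : R -> R) : bcont g ->
  mu.-integrable setT (EFin \o h) ->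
  mu.-integrable setT (EFin \o (fun t => Re (g t) * h t)).
Proof.
move=> [g1 g2 [M gM]] ih.
have := @integrableMr _ _ R mu setT measurableT (fun t => Re (g t)) (EFin \o h)
  (continuous_measurable_fun g1) _ ih.
apply; apply: (@bounded_of_le _ M) => t; exact: le_trans (normRe_le _) (gM t).
Qed.

Lemma integrableM_bcontIm g (h : R -> R) : bcont g ->
  mu.-integrable setT (EFin \o h) ->
  mu.-integrable setT (EFin \o (fun t => Im (g t) * h t)).
Proof.
move=> [g1 g2 [M gM]] ih.
have := @integrableMr _ _ R mu setT measurableT (fun t => Im (g t)) (EFin \o h)
  (continuous_measurable_fun g2) _ ih.
apply; apply: (@bounded_of_le _ M) => t; exact: le_trans (normIm_le _) (gM t).
Qed.

Lemma integrable_EFinD (h1 h2 : R -> R) :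
  mu.-integrable setT (EFin \o h1) -> mu.-integrable setT (EFin \o h2) ->
  mu.-integrable setT (EFin \o (fun t => h1 t + h2 t)).
Proof. by move=> i1 i2; have := integrableD measurableT i1 i2. Qed.

Lemma integrable_EFinB (h1 h2 : R -> R) :
  mu.-integrable setT (EFin \o h1) -> mu.-integrable setT (EFin \o h2) ->
  mu.-integrable setT (EFin \o (fun t => h1 t - h2 t)).
Proof. by move=> i1 i2; have := integrableB measurableT i1 i2. Qed.

Lemma cintegrable0 : cintegrable (fun=> 0).
Proof. by split; exact: integrable0. Qed.

Lemma cintegrableD f g : cintegrable f -> cintegrable g ->
  cintegrable (fun t => f t + g t).
Proof.
move=> [f1 f2] [g1 g2]; split.
  by under eq_fun do rewrite ReD; exact: integrable_EFinD.
by under eq_fun do rewrite ImD; exact: integrable_EFinD.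
Qed.

Lemma cintegrable_sum (I : Type) (r : seq I) (F : I -> R -> C) :
  (forall i, cintegrable (F i)) -> cintegrable (fun t => \sum_(i <- r) F i t).
Proof.
move=> HF; elim: r => [|i r IH].
  by under eq_fun do rewrite big_nil; exact: cintegrable0.
by under eq_fun do rewrite big_cons; exact: cintegrableD.
Qed.

Lemma cintegrableM g f : bcont g -> cintegrable f -> cintegrable (fun t => g t * f t).
Proof.
move=> bg [f1 f2]; split.
  under eq_fun do rewrite ReM.
  by apply: integrable_EFinB; [exact: integrableM_bcontRe|exact: integrableM_bcontIm].
under eq_fun do rewrite ImM.
by apply: integrable_EFinD; [exact: integrableM_bcontRe|exact: integrableM_bcontIm].
Qed.

Lemma cintD f g : cintegrable f -> cintegrable g ->
  cint mu (fun t => f t + g t) = cint mu f + cint mu g.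
Proof.
move=> [f1 f2] [g1 g2]; apply: complex_ReIm.
  rewrite ReD /=; under [LHS]eq_Rintegral do rewrite ReD.
  exact: RintegralD.
rewrite ImD /=; under [LHS]eq_Rintegral do rewrite ImD.
exact: RintegralD.
Qed.

Lemma cintZ c f : cintegrable f -> cint mu (fun t => c * f t) = c * cint mu f.
Proof.
move=> [f1 f2]; have i1 r := RintegralZl r measurableT f1.
have i2 r := RintegralZl r measurableT f2.
have m1 r : mu.-integrable setT (EFin \o (fun t => r * Re (f t))).
  by have := integrableZl measurableT r f1.
have m2 r : mu.-integrable setT (EFin \o (fun t => r * Im (f t))).
  by have := integrableZl measurableT r f2.
apply: complex_ReIm.
  rewrite ReM /=; under [LHS]eq_Rintegral do rewrite ReM.
  by rewrite RintegralB // i1 i2.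
rewrite ImM /=; under [LHS]eq_Rintegral do rewrite ImM.
by rewrite RintegralD // i1 i2.
Qed.

Lemma cint0 : cint mu (fun=> 0) = 0.
Proof. by apply: complex_ReIm; rewrite /= Rintegral_cst // mul0r. Qed.

Lemma cint_sum (I : Type) (r : seq I) (F : I -> R -> C) :
  (forall i, cintegrable (F i)) ->
  cint mu (fun t => \sum_(i <- r) F i t) = \sum_(i <- r) cint mu (F i).
Proof.
move=> HF; elim: r => [|i r IH].
  by under eq_fun do rewrite big_nil; rewrite big_nil cint0.
under eq_fun do rewrite big_cons.
by rewrite big_cons cintD ?IH //; exact: cintegrable_sum.
Qed.

Lemma cint_conj f : cintegrable f ->
  cint mu (fun t => Num.conj (f t)) = Num.conj (cint mu f).
Proof.
move=> [f1 f2]; apply: complex_ReIm.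
  by rewrite Re_conj /=; under [LHS]eq_Rintegral do rewrite Re_conj.
rewrite Im_conj /=; under [LHS]eq_Rintegral do rewrite Im_conj -mulN1r.
by rewrite RintegralZl // mulN1r.
Qed.

Lemma cint_ge0 f : (forall t, 0 <= f t) -> 0 <= cint mu f.
Proof.
move=> f0; rewrite lecE /=; apply/andP; split.
  rewrite (_ : Rintegral _ _ _ = 0) //.
  under eq_Rintegral do rewrite ger0_Im //.
  by rewrite Rintegral_cst // mul0r.
apply: Rintegral_ge0 => t _.
by have := f0 t; rewrite lecE => /andP[].
Qed.

Lemma le_Re_cint f g : cintegrable f -> cintegrable g ->
  (forall t, Re (f t) <= Re (g t)) -> Re (cint mu f) <= Re (cint mu g).
Proof. by move=> [f1 _] [g1 _] fg; apply: le_Rintegral. Qed.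

End WithMeasure.
End ComplexIntegral.

(** * Adjoints, positivity and square roots of matrices *)

Section Matrices.
Variable R : realType.
Local Notation C := (C R).

Section Adjoint.
Implicit Types m n p : nat.

Lemma adjE m n (A : 'M[C]_(m, n)) a c : adj A a c = Num.conj (A c a).
Proof. by rewrite !mxE. Qed.

Lemma adjK m n (A : 'M[C]_(m, n)) : adj (adj A) = A.
Proof. by apply/matrixP => a c; rewrite !adjE conjCK. Qed.

Lemma adjM m n p (A : 'M[C]_(m, n)) (B : 'M[C]_(n, p)) :
  adj (A *m B) = adj B *m adj A.
Proof. by rewrite /adj trmx_mul map_mxM. Qed.

Lemma adjD m n (A B : 'M[C]_(m, n)) : adj (A + B) = adj A + adj B.
Proof. by apply/matrixP => a c; rewrite !mxE rmorphD. Qed.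

Lemma adjN m n (A : 'M[C]_(m, n)) : adj (- A) = - adj A.
Proof. by apply/matrixP => a c; rewrite !mxE rmorphN. Qed.

Lemma adjZ m n (x : C) (A : 'M[C]_(m, n)) : adj (x *: A) = Num.conj x *: adj A.
Proof. by apply/matrixP => a c; rewrite !mxE rmorphM. Qed.

Lemma adj0 m n : adj (0 : 'M[C]_(m, n)) = 0.
Proof. by apply/matrixP => a c; rewrite !mxE rmorph0. Qed.

Lemma adj1 n : adj (1%:M : 'M[C]_n) = 1%:M.
Proof. by rewrite /adj trmx1 map_mx1. Qed.

Lemma adj_tr m n (A : 'M[C]_(m, n)) : adj A^T = (adj A)^T.
Proof. by apply/matrixP => a c; rewrite !mxE. Qed.

Lemma adj_unitmx n (A : 'M[C]_n) : (adj A \in unitmx) = (A \in unitmx).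
Proof. by rewrite map_unitmx unitmx_tr. Qed.

Lemma dot_ge0 n (v : 'cV[C]_n) : 0 <= (adj v *m v) 0 0.
Proof.
by rewrite mxE; apply: sumr_ge0 => i _; rewrite adjE mulrC mul_conjC_ge0.
Qed.

Lemma dot_eq0 n (v : 'cV[C]_n) : ((adj v *m v) 0 0 == 0) = (v == 0).
Proof.
apply/eqP/eqP => [|->]; last by rewrite mulmx0 mxE.
have ge i : true -> 0 <= adj v 0 i * v i 0.
  by move=> _; rewrite adjE mulrC mul_conjC_ge0.
rewrite mxE => e; apply/matrixP => i j; rewrite ord1 [RHS]mxE; apply/eqP.
have /eqP : adj v 0 i * v i 0 = 0 by apply: (psumr_eq0P ge e).
by rewrite adjE mulrC mul_conjC_eq0.
Qed.

Lemma posdef_psd n (A : 'M[C]_n) : posdef A -> psd A.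
Proof.
by move=> pA v; have [->|/pA/ltW//] := eqVneq v 0; rewrite mulmx0 mxE.
Qed.

Lemma posdef_unitmx n (A : 'M[C]_n) : posdef A -> A \in unitmx.
Proof.
move=> pA; rewrite -unitmx_tr -row_free_unit; apply: inj_row_free => v vA.
apply/eqP; apply: contraTT isT => v0.
have w0 : v^T != 0 by rewrite trmx_eq0.
have := pA _ w0; rewrite -mulmxA (_ : A *m v^T = 0) ?mulmx0 ?mxE ?ltxx //.
by apply: trmx_inj; rewrite trmx_mul trmxK vA trmx0.
Qed.

Lemma psd_congr m n (A : 'M[C]_n) (B : 'M[C]_(n, m)) : psd A -> psd (adj B *m A *m B).
Proof. by move=> pA v; have := pA (B *m v); rewrite adjM !mulmxA. Qed.

Lemma psd_tr n (A : 'M[C]_n) : psd A -> psd A^T.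
Proof.
move=> pA v; have := pA (adj v^T).
suff -> : adj v *m A^T *m v = (adj (adj v^T) *m A *m adj v^T)^T by rewrite [_^T 0 0]mxE.
by rewrite !trmx_mul adjK trmxK adj_tr trmxK mulmxA.
Qed.

Lemma eq_of_subr (V : zmodType) (a b a' b' : V) : a' = b' -> a - b = a' - b' -> a = b.
Proof. by move=> -> /eqP; rewrite subrr subr_eq0 => /eqP. Qed.

(* Polarization with the scalars 1 and i. *)
Lemma sesqui_ge0_herm (V : lmodType C) (F : V -> V -> C) :
    (forall u1 u2 w x, F (u1 + x *: u2) w = F u1 w + Num.conj x * F u2 w) ->
    (forall u1 u2 w x, F w (u1 + x *: u2) = F w u1 + x * F w u2) ->
    (forall u, 0 <= F u u) ->
  forall u v, F u v = Num.conj (F v u).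
Proof.
move=> Fl Fr F0 u v.
have re (x : C) : 0 <= x -> Num.conj x = x by move=> /ger0_real/CrealP.
have bil x : F (u + x *: v) (u + x *: v) =
    F u u + x * F u v + Num.conj x * (F v u + x * F v v).
  by rewrite Fl !Fr.
have h1 := re _ (F0 (u + 1 *: v)); have h2 := re _ (F0 (u + 'i *: v)).
have hu := re _ (F0 u); have hv := re _ (F0 v).
move: h1 h2; rewrite !bil !(rmorphD, rmorphM) /= hu hv ?rmorph1 ?conjCK !conjCi.
move: (F u v) (F v u) (F u u) (F v v) => p q pu pv.
have := sqrCi C; have := neq0Ci C; move: (Num.conj p) (Num.conj q) => p' q'.
move: ('i) => i i0 i2 h1 h2.
have e1 : p' + q' = p + q by apply: (eq_of_subr h1); ring.
have e2 : i * (q' - p') = i * (p - q) by apply: (eq_of_subr h2); ring.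
have e3 := mulfI i0 e2.
have e4 : 2 * q' = 2 * p by rewrite !mulr_natl !mulr2n; apply: (eq_of_subr (congr2 +%R e1 e3)); ring.
by apply/esym; apply: mulfI e4; rewrite pnatr_eq0.
Qed.

(** [psd] does not mention symmetry. It follows by polarization, because [0 <= x] in [C] includes
    that [x] is real. *)
Lemma psd_herm n (A : 'M[C]_n) : psd A -> adj A = A.
Proof.
move=> pA.
have D00 (A1 A2 : 'M[C]_1) : (A1 + A2) 0 0 = A1 0 0 + A2 0 0 by rewrite mxE.
have Z00 x (A1 : 'M[C]_1) : (x *: A1) 0 0 = x * A1 0 0 by rewrite mxE.
have key := @sesqui_ge0_herm _ (fun u v : 'cV[C]_n => (adj u *m A *m v) 0 0)
  (fun u1 u2 w x => _) (fun u1 u2 w x => _) pA.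
have {}key : forall u v : 'cV[C]_n,
    (adj u *m A *m v) 0 0 = Num.conj ((adj v *m A *m u) 0 0).
  apply: key => [u1 u2 w x|u1 u2 w x].
    by rewrite adjD adjZ 2!mulmxDl D00 -2!scalemxAl Z00.
  by rewrite mulmxDr D00 -scalemxAr Z00.
apply/matrixP => a c; rewrite adjE.
have entry (B : 'M[C]_n) i j :
    B i j = (adj (delta_mx i 0 : 'cV[C]_n) *m B *m (delta_mx j 0 : 'cV[C]_n)) 0 0.
  have -> : adj (delta_mx i 0 : 'cV[C]_n) = delta_mx 0 i.
    by apply/matrixP => x y; rewrite !mxE andbC rmorph_nat.
  by rewrite -rowE -colE !mxE.
by rewrite (entry A a c) key -entry.
Qed.

Lemma posdef_inv n (A : 'M[C]_n) : posdef A -> posdef (invmx A).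
Proof.
move=> pA v v0; have uA := posdef_unitmx pA.
have w0 : invmx A *m v != 0.
  by apply: contra_neq v0 => e; rewrite -[v]mul1mx -(mulmxV uA) -mulmxA e mulmx0.
have := pA _ w0; rewrite adjM -!mulmxA (mulmxA A) mulmxV // mul1mx.
suff -> : adj (invmx A) = invmx A by [].
have e : adj (invmx A) *m A = 1%:M.
  by rewrite -{2}(psd_herm (posdef_psd pA)) -adjM mulmxV // adj1.
by rewrite -[LHS]mulmx1 -(mulmxV uA) mulmxA e mul1mx.
Qed.

Lemma posdef_tr n (A : 'M[C]_n) : posdef A -> posdef A^T.
Proof.
move=> pA v v0; have uA := posdef_unitmx pA.
rewrite lt_neqAle (psd_tr (posdef_psd pA)) andbT eq_sym.
have w0 : adj v^T != 0.
  by apply: contra_neq v0 => e; rewrite -[v]trmxK -[v^T]adjK e adj0 trmx0.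
have -> : adj v *m A^T *m v = (adj (adj v^T) *m A *m adj v^T)^T.
  by rewrite !trmx_mul adjK trmxK adj_tr trmxK mulmxA.
by rewrite [_^T 0 0]mxE gt_eqF // pA.
Qed.

(** The i-th diagonal entry is the form of A at the i-th column of D. *)
Lemma tr_congr_ge0 m n (A : 'M[C]_n) (D : 'M[C]_(n, m)) :
  psd A -> forall i, 0 <= (adj D *m A *m D) i i.
Proof.
move=> pA i; have := pA (col i D).
have -> : adj (col i D) = row i (adj D) by apply/matrixP => x y; rewrite !mxE.
rewrite -2!row_mul (_ : adj D *m A *m col i D = col i (adj D *m A *m D)).
  by rewrite [row _ _ _ _]mxE [col _ _ _ _]mxE.
by rewrite !colE mulmxA.
Qed.

Lemma tr_congr_eq0 m n (A : 'M[C]_n) (D : 'M[C]_(n, m)) :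
  posdef A -> \tr (adj D *m A *m D) = 0 -> D = 0.
Proof.
move=> pA tr0; apply/matrixP => a c.
have c0 : col c D = 0.
  have ge i : true -> 0 <= (adj D *m A *m D) i i.
    by move=> _; apply: tr_congr_ge0; exact: posdef_psd.
  have : (adj D *m A *m D) c c = 0 by apply: (psumr_eq0P ge tr0).
  move=> e; apply/eqP; apply: contraTT isT => /pA.
  have -> : adj (col c D) = row c (adj D) by apply/matrixP => x y; rewrite !mxE.
  rewrite -2!row_mul (_ : adj D *m A *m col c D = col c (adj D *m A *m D)).
    by rewrite [row _ _ _ _]mxE [col _ _ _ _]mxE e ltxx.
  by rewrite !colE mulmxA.
by have /matrixP/(_ a 0) := c0; rewrite !mxE.
Qed.

(* tr (D^dag A D) = - tr (D B D^dag), and both traces are nonnegative. *)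
Lemma sylvester_eq0 m n (A : 'M[C]_m) (B : 'M[C]_n) (D : 'M[C]_(m, n)) :
  posdef A -> posdef B -> A *m D = - (D *m B) -> D = 0.
Proof.
move=> pA pB e; apply: (tr_congr_eq0 pA); apply/eqP; rewrite eq_le.
have ge p q (M : 'M[C]_p) (E : 'M[C]_(p, q)) : posdef M -> 0 <= \tr (adj E *m M *m E).
  by move=> pM; apply: sumr_ge0 => i _; apply: tr_congr_ge0; exact: posdef_psd.
rewrite (ge _ _ _ _ pA) andbT -mulmxA e mulmxN raddfN /= oppr_le0.
by rewrite mxtrace_mulC -[D in D *m B *m _]adjK ge.
Qed.

(** With equal squares, S = B + K and D = B - K satisfy S D = - D S. Since S is positive definite,
    [sylvester_eq0] forces D = 0. *)
Lemma psd_sqrt_uniq n (B K : 'M[C]_n) : psd B -> posdef K -> B *m B = K *m K -> B = K.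
Proof.
move=> pB pK e.
have pS : posdef (B + K).
  by move=> v v0; rewrite mulmxDr mulmxDl mxE ltr_wpDl ?pB ?pK.
apply/eqP; rewrite -subr_eq0; apply/eqP; apply: (sylvester_eq0 pS pS).
rewrite !(mulmxBl, mulmxBr, mulmxDl, mulmxDr) e.
move: (K *m K) (B *m K) (K *m B) => X Y Z.
by apply/matrixP => a c; rewrite !mxE; ring.
Qed.

(** [sqrtm] is a choice among psd roots; uniqueness identifies it with any positive definite root at
    hand. This is how [rhoL] and [rhoR] get computed. *)
Lemma sqrtm_posdef n (A K : 'M[C]_n) : posdef K -> K *m K = A -> sqrtm A = K.
Proof.
move=> pK e; have [pB eB] := xgetPex 0 (ex_intro
  (fun B : 'M[C]_n => psd B /\ B *m B = A) K (conj (posdef_psd pK) e)).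
by apply: psd_sqrt_uniq => //; rewrite e.
Qed.

End Adjoint.
End Matrices.

Section MatrixIntegral.
Variable R : realType.
Local Notation C := (C R).
Local Notation Re := (@complex.Re R).
Local Notation Im := (@complex.Im R).

Definition bmat m n (A : R -> 'M[C]_(m, n)) : Prop :=
  forall a c, bcont (fun t => A t a c).

Lemma bmat_cst m n (A : 'M[C]_(m, n)) : bmat (fun=> A).
Proof. by move=> a c; exact: bcont_cst. Qed.

Lemma bmatZ m n (g : R -> C) (A : R -> 'M[C]_(m, n)) : bcont g -> bmat A ->
  bmat (fun t => g t *: A t).
Proof. by move=> bg bA a c; under eq_fun do rewrite mxE; exact: bcontM. Qed.

Lemma bmat_adj m n (A : R -> 'M[C]_(m, n)) : bmat A -> bmat (fun t => adj (A t)).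
Proof. by move=> bA a c; under eq_fun do rewrite adjE; exact: bcont_conj. Qed.

Lemma bmat_sum m n (I : Type) (r : seq I) (F : I -> R -> 'M[C]_(m, n)) :
  (forall i, bmat (F i)) -> bmat (fun t => \sum_(i <- r) F i t).
Proof.
move=> bF a c; under eq_fun do rewrite summxE.
by apply: bcont_sum => i; exact: bF.
Qed.

Variable mu : {measure set R -> \bar R}.

Definition mintegrable m n (G : R -> 'M[C]_(m, n)) : Prop :=
  forall a c, cintegrable mu (fun t => G t a c).

Lemma mintegrableZ m n (g : R -> C) (G : R -> 'M[C]_(m, n)) :
  bcont g -> mintegrable G -> mintegrable (fun t => g t *: G t).
Proof. by move=> bg iG a c; under eq_fun do rewrite mxE; exact: cintegrableM. Qed.

Lemma mintegrable_mull m n p (A : R -> 'M[C]_(m, n)) (G : R -> 'M[C]_(n, p)) :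
  bmat A -> mintegrable G -> mintegrable (fun t => A t *m G t).
Proof.
move=> bA iG a c; under eq_fun do rewrite mxE.
by apply: cintegrable_sum => i; exact: cintegrableM.
Qed.

Lemma mintegrable_mulr m n p (G : R -> 'M[C]_(m, n)) (A : R -> 'M[C]_(n, p)) :
  bmat A -> mintegrable G -> mintegrable (fun t => G t *m A t).
Proof.
move=> bA iG a c; under eq_fun do rewrite mxE.
apply: cintegrable_sum => i; under eq_fun do rewrite mulrC.
exact: cintegrableM.
Qed.

Lemma mintegrable_tr m n (G : R -> 'M[C]_(m, n)) :
  mintegrable G -> mintegrable (fun t => (G t)^T).
Proof. by move=> iG a c; under eq_fun do rewrite mxE. Qed.

Lemma mintD m n (G H : R -> 'M[C]_(m, n)) : mintegrable G -> mintegrable H ->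
  mint mu (fun t => G t + H t) = mint mu G + mint mu H.
Proof.
move=> iG iH; apply/matrixP => a c; rewrite !mxE -cintD //.
by congr cint; apply/funext => t; rewrite mxE.
Qed.

Lemma mintZ m n (x : C) (G : R -> 'M[C]_(m, n)) : mintegrable G ->
  mint mu (fun t => x *: G t) = x *: mint mu G.
Proof.
move=> iG; apply/matrixP => a c; rewrite !mxE -cintZ //.
by congr cint; apply/funext => t; rewrite mxE.
Qed.

Lemma mintN m n (G : R -> 'M[C]_(m, n)) : mintegrable G ->
  mint mu (fun t => - G t) = - mint mu G.
Proof.
move=> iG; rewrite -scaleN1r -mintZ //; congr mint.
by apply/funext => t; rewrite scaleN1r.
Qed.

Lemma mint_mull m n p (A : 'M[C]_(m, n)) (G : R -> 'M[C]_(n, p)) : mintegrable G ->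
  mint mu (fun t => A *m G t) = A *m mint mu G.
Proof.
move=> iG; apply/matrixP => a c; rewrite !mxE.
under eq_fun do rewrite mxE.
rewrite cint_sum; last by move=> i; apply: cintegrableM; [exact: bcont_cst|].
by apply: eq_bigr => i _; rewrite mxE cintZ.
Qed.

Lemma mint_mulr m n p (G : R -> 'M[C]_(m, n)) (A : 'M[C]_(n, p)) : mintegrable G ->
  mint mu (fun t => G t *m A) = mint mu G *m A.
Proof.
move=> iG; apply/matrixP => a c; rewrite !mxE.
under eq_fun do rewrite mxE; under eq_fun do under eq_bigr do rewrite mulrC.
rewrite cint_sum; last by move=> i; apply: cintegrableM; [exact: bcont_cst|].
by apply: eq_bigr => i _; rewrite mxE cintZ // mulrC.
Qed.

Lemma mint_tr m n (G : R -> 'M[C]_(m, n)) :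
  mint mu (fun t => (G t)^T) = (mint mu G)^T.
Proof. by apply/matrixP => a c; rewrite !mxE; under eq_fun do rewrite mxE. Qed.

Lemma mint_adj m n (G : R -> 'M[C]_(m, n)) : mintegrable G ->
  mint mu (fun t => adj (G t)) = adj (mint mu G).
Proof.
move=> iG; apply/matrixP => a c; rewrite adjE !mxE -cint_conj //.
by congr cint; apply/funext => t; rewrite adjE.
Qed.

Lemma eq_mint m n (G H : R -> 'M[C]_(m, n)) : G =1 H -> mint mu G = mint mu H.
Proof. by move=> /funext ->. Qed.

Lemma mint0 m n : mint mu (fun=> 0 : 'M[C]_(m, n)) = 0.
Proof. by apply/matrixP => a c; rewrite !mxE -[RHS](cint0 mu); congr cint; apply/funext => t; rewrite mxE. Qed.

(** Here 2 t/(t-z) = 1 + (t+z)/(t-z), and the real part of the last quotient is the Poisson kernel,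
    which is nonnegative. *)
Lemma Re_cauchy_ge (t : R) (z : C) : `|z| < 1 ->
  1 <= Re (2 * (expi t / (expi t - z))).
Proof.
move=> z1; have tz := expi_subz_neq0 t z1.
have -> : 2 * (expi t / (expi t - z)) = 1 + (expi t + z) / (expi t - z) :> C.
  by field.
rewrite ReD lerDl.
have cc : Num.conj (expi t - z) != 0 by rewrite conjC_eq0.
rewrite invC_norm mulrA.
rewrite (_ : (expi t + z) * `|expi t - z| ^- 2 = `|expi t - z| ^- 2 * (expi t + z)); last by rewrite mulrC.
rewrite -mulrA.
have n0 : 0 < `|expi t - z| ^- 2 by rewrite invr_gt0 exprn_gt0 // normr_gt0.
(* Twice the real part of (t+z) conj(t-z) equals 2 (1 - |z|^2) when |t| = 1. *)
have : 0 <= (expi t + z) * Num.conj (expi t - z) + Num.conj ((expi t + z) * Num.conj (expi t - z)).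
  rewrite !(rmorphM, rmorphD, rmorphN) /= !conjCK.
  have e1 := normCK (expi t : C); have e2 := normCK z; rewrite norm_expi in e1.
  rewrite (_ : _ + _ = 2 * (1 - `|z| ^+ 2)); last by rewrite e2; apply: (eq_of_subr (congr1 (fun x => - 2 * x) e1)); ring.
  by rewrite mulr_ge0 // subr_ge0 expr_le1 // ltW.
set w := _ * _ => h.
rewrite ReM; have := ltW n0; rewrite lecE => /andP[/eqP -> r0].
rewrite mul0r subr0 mulr_ge0 //.
move: h; rewrite lecE ReD Re_conj => /andP[_] /=; lra.
Qed.

(* The numerical range of the integral lies in Re >= 1/2. *)
Lemma cauchy_integral_unit n (G : R -> 'M[C]_n) (z : C) : `|z| < 1 ->
  (forall t, psd (G t)) -> mintegrable G -> mint mu G = 1%:M ->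
  mint mu (fun t => (expi t / (expi t - z)) *: G t) \in unitmx.
Proof.
move=> z1 pG iG G1.
rewrite -unitmx_tr -row_free_unit; apply: inj_row_free => r rM; apply/eqP.
pose v := r^T; rewrite -[r]trmxK trmx_eq0 -/v -dot_eq0.
have bk : bcont (fun t => expi t / (expi t - z)).
  by apply: bcontM; [exact: bcont_expi|exact: bcont_cauchy].
have iF : mintegrable (fun t => (expi t / (expi t - z)) *: G t) by exact: mintegrableZ.
have Mv : mint mu (fun t => (expi t / (expi t - z)) *: G t) *m v = 0.
  by apply: trmx_inj; rewrite trmx_mul trmxK rM trmx0.
pose s t := (adj v *m G t *m v) 0 0.
have is_ : cintegrable mu s.
  have := mintegrable_mulr (bmat_cst v) (mintegrable_mull (bmat_cst (adj v)) iG).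
  by move/(_ 0 0).
have e1 : cint mu s = (adj v *m v) 0 0.
  rewrite -[adj v in RHS]mulmx1 -G1 -mint_mull // -mint_mulr; first by rewrite mxE.
  exact: mintegrable_mull (bmat_cst _) iG.
(* A kernel vector v makes this integral vanish, while its real part is at least the integral of
   v^dag G v, which is v^dag v. *)
have e2 : cint mu (fun t => 2 * (expi t / (expi t - z)) * s t) = 0.
  under eq_fun do rewrite -mulrA.
  rewrite cintZ; last exact: cintegrableM.
  have : (adj v *m (mint mu (fun t => (expi t / (expi t - z)) *: G t) *m v)) 0 0 = 0.
    by rewrite Mv mulmx0 mxE.
  rewrite -mint_mulr // -mint_mull; last exact: mintegrable_mulr (bmat_cst _) _.
  rewrite mxE => e; rewrite -[RHS](mulr0 2) -e; congr (_ * cint _ _).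
  by apply/funext => t; rewrite -scalemxAl -scalemxAr mxE mulmxA.
rewrite eq_le dot_ge0 andbT lecE -e1.
have s0 t : 0 <= s t by exact: pG.
have c0 := cint_ge0 mu s0.
rewrite [Im (cint mu s)](ger0_Im c0) eqxx andTb -e2.
apply: le_Re_cint => //.
  by apply: cintegrableM => //; apply: bcontM => //; exact: bcont_cst.
move=> t; rewrite ReM (ger0_Im (s0 t)) mulr0 subr0 ler_peMl //; last exact: Re_cauchy_ge.
by have := s0 t; rewrite lecE => /andP[].
Qed.

End MatrixIntegral.

(** * Matrix polynomials: evaluation, reversal and transposition *)

Section MatrixPolynomials.
Variables (R : realType) (d : nat).
Local Notation C := (C R).
Local Notation Md := 'M[C]_d.+1.
Implicit Types (p q : {poly Md}) (c : Md) (z : C) (n : nat).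

Definition ev p z : Md := p.[z%:M].

Lemma ev_wide n p z : (size p <= n)%N -> ev p z = \sum_(k < n) z ^+ k *: p`_k.
Proof.
move=> pn; rewrite /ev (horner_coef_wide _ pn); apply: eq_bigr => i _.
by rewrite -mul_mx_scalar rmorphXn.
Qed.

Lemma comm_scalar p z : comm_poly p z%:M.
Proof. by apply: comm_coef_poly => i; exact: scalar_mxC. Qed.

Lemma evD p q z : ev (p + q) z = ev p z + ev q z.
Proof. exact: hornerD. Qed.

Lemma evN p z : ev (- p) z = - ev p z.
Proof. exact: hornerN. Qed.

Lemma evM p q z : ev (p * q) z = ev p z *m ev q z.
Proof. by rewrite /ev hornerM_comm //; exact: comm_scalar. Qed.

Lemma evC c z : ev c%:P z = c.
Proof. exact: hornerC. Qed.

Lemma evX z : ev 'X z = z%:M.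
Proof. exact: hornerX. Qed.

Lemma evXM p z : ev ('X * p) z = z *: ev p z.
Proof. by rewrite evM evX mul_scalar_mx. Qed.

(** The difference quotient of p at z. Its degree is one lower than that of p, which is what the
    orthogonality arguments for Cauchy transforms exploit. *)
Lemma ev_factor p z : exists2 q, p = q * ('X - z%:M%:P) + (ev p z)%:P &
  (size q <= (size p).-1)%N.
Proof.
have /factor_theorem[q e] : root (p - (ev p z)%:P) z%:M.
  by rewrite /root hornerD hornerN hornerC subrr.
exists q; first by rewrite -e subrK.
have [->|q0] := eqVneq q 0; first by rewrite size_poly0.
have -> : p = q * ('X - z%:M%:P) + (ev p z)%:P by rewrite -e subrK.
rewrite size_polyDl size_Mmonic ?monicXsubC // size_XsubC addn2 //=.
rewrite ltnS; apply: leq_trans (size_polyC_leq1 _) _.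
by rewrite lt0n size_poly_eq0.
Qed.

Lemma ev_factor_at p z : exists2 q : {poly Md}, (size q <= (size p).-1)%N &
  forall x, ev p x = ev q x *m (x%:M - z%:M) + ev p z.
Proof.
have [q e sq] := ev_factor p z; exists q => // x.
by rewrite {1}e evD evM evC evD evN evC evX.
Qed.

(* On the circle, [star n p] is t^n p(t)^dag; see [ev_star_circle]. *)
Definition star n p : {poly Md} := \poly_(i < n.+1) adj p`_(n - i).

Lemma size_star n p : (size (star n p) <= n.+1)%N.
Proof. exact: size_poly. Qed.

Lemma coef_star n p i : (star n p)`_i = if (i < n.+1)%N then adj p`_(n - i) else 0.
Proof. exact: coef_poly. Qed.

Lemma starD n p q : star n (p + q) = star n p + star n q.
Proof.
apply/polyP => i; rewrite coefD !coef_star; case: ifP => _; last by rewrite addr0.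
by rewrite coefD adjD.
Qed.

Lemma starCM n p c : star n (c%:P * p) = star n p * (adj c)%:P.
Proof.
apply/polyP => i; rewrite coefMC !coef_star; case: ifP => _; last by rewrite mul0r.
by rewrite coefCM -!mulmxE adjM.
Qed.

Lemma starXM n p : star n.+1 ('X * p) = star n p.
Proof.
apply/polyP => i; rewrite !coef_star coefXM ltnS leq_eqVlt.
have [->|in1] /= := eqVneq i n.+1; first by rewrite ltnn subnn eqxx adj0.
case: ifP => // iln; rewrite subSn //.
Qed.

Lemma star_lift n p : (size p <= n.+1)%N -> star n.+1 p = 'X * star n p.
Proof.
move=> pn; apply/polyP => -[|i]; rewrite coefXM !coef_star //=.
by rewrite subn0 nth_default // adj0.
Qed.

Lemma starK n p : (size p <= n.+1)%N -> star n (star n p) = p.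
Proof.
move=> pn; apply/polyP => i; rewrite coef_star; case: ltnP => [iln|nli].
  by rewrite coef_star ltnS leq_subr subKn // adjK.
by rewrite nth_default // (leq_trans pn).
Qed.

Lemma ev_star n p z : (size p <= n.+1)%N -> z != 0 ->
  ev (star n p) z = z ^+ n *: adj (ev p (Num.conj z)^-1).
Proof.
move=> pn z0; rewrite (ev_wide _ (size_star n p)) (ev_wide _ pn).
rewrite (reindex_inj rev_ord_inj) /=.
have adj_sum (F : 'I_n.+1 -> Md) : adj (\sum_k F k) = \sum_k adj (F k).
  by elim/big_ind2: _ => [|_ A _ B <- <-|//]; rewrite ?adj0 ?adjD.
rewrite adj_sum scaler_sumr; apply: eq_bigr => i _.
rewrite coef_star subSS ltnS leq_subr subKn; last by rewrite -ltnS.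
rewrite adjZ scalerA; congr (_ *: _).
rewrite rmorphXn /= fmorphV /= conjCK exprVn -expfB_cond ?(negPf z0) // add0n.
by rewrite -ltnS.
Qed.

Lemma ev_star_circle n p t : (size p <= n.+1)%N ->
  ev (star n p) (expi t) = expi t ^+ n *: adj (ev p (expi t)).
Proof.
by move=> pn; rewrite (ev_star pn (expi_neq0 t)) conj_expi invrK.
Qed.

(** Transposing coefficients reverses products, so it exchanges left and right orthonormal
    polynomials when [W] is replaced by its transpose. Left-hand statements are derived from
    right-hand ones in this way. *)
Definition trp p : {poly Md} := map_poly trmx p.

Lemma coef_trp p i : (trp p)`_i = (p`_i)^T.
Proof. by rewrite coef_map_id0 // trmx0. Qed.

Lemma size_trp p : size (trp p) = size p.
Proof. by rewrite size_map_inj_poly //; [exact: trmx_inj|exact: trmx0]. Qed.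

Lemma lead_coef_trp p : lead_coef (trp p) = (lead_coef p)^T.
Proof. by rewrite lead_coefE size_trp coef_trp. Qed.

Lemma trpK p : trp (trp p) = p.
Proof. by apply/polyP => i; rewrite !coef_trp trmxK. Qed.

Lemma trpD p q : trp (p + q) = trp p + trp q.
Proof. by apply/polyP => i; rewrite coefD !coef_trp coefD linearD. Qed.

Lemma trpXM p : trp ('X * p) = 'X * trp p.
Proof. by apply/polyP => i; rewrite coefXM !coef_trp coefXM; case: ifP; rewrite ?trmx0. Qed.

Lemma trpMC p c : trp (p * c%:P) = (c^T)%:P * trp p.
Proof. by apply/polyP => i; rewrite coefCM !coef_trp coefMC -!mulmxE trmx_mul. Qed.

Lemma trp1 : trp 1 = 1.
Proof. by apply/polyP => i; rewrite coef_trp !coef1; case: eqP => _; rewrite ?trmx1 ?trmx0. Qed.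

Lemma ev_trp p z : ev (trp p) z = (ev p z)^T.
Proof.
rewrite (ev_wide z (leqnn (size p))) (ev_wide z (eq_leq (size_trp p))).
rewrite linear_sum; apply: eq_bigr => i _; by rewrite linearZ /= coef_trp.
Qed.

Lemma star_trp n p : star n (trp p) = trp (star n p).
Proof.
apply/polyP => i; rewrite coef_trp !coef_star; case: ifP => _; rewrite ?trmx0 //.
by rewrite coef_trp adj_tr.
Qed.

Lemma bmat_ev p : bmat (fun t => ev p (expi t)).
Proof.
under eq_fun do rewrite (ev_wide _ (leqnn _)).
by apply: bmat_sum => i; apply: bmatZ; [exact: bcont_expiX|exact: bmat_cst].
Qed.

End MatrixPolynomials.

(** * Orthonormal polynomials and the Szego recursion *)

Section InnerProduct.
Variables (R : realType) (d : nat).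
Local Notation C := (C R).
Local Notation Md := 'M[C]_d.+1.
Variable mu : {measure set R -> \bar R}.
Implicit Types (p q g h : {poly Md}) (c : Md) (z : C) (n : nat).

Section OneSided.
Variable W : R -> Md.
Hypothesis HW : is_matrix_measure mu W.

Lemma mintegrableW : mintegrable mu W.
Proof. by case: HW => _ []. Qed.

Lemma adjW t : adj (W t) = W t.
Proof. by case: HW => pW _; exact: psd_herm. Qed.

Lemma mintegrable_sandwich m n (A : R -> 'M[C]_(m, d.+1)) (B : R -> 'M[C]_(d.+1, n)) :
  bmat A -> bmat B -> mintegrable mu (fun t => A t *m W t *m B t).
Proof.
move=> bA bB; apply: mintegrable_mulr => //; apply: mintegrable_mull => //.
exact: mintegrableW.
Qed.

Lemma mintegrable_ip g h :
  mintegrable mu (fun t => adj (mpoly_at g t) *m W t *m mpoly_at h t).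
Proof.
by apply: mintegrable_sandwich; [apply: bmat_adj; exact: bmat_ev|exact: bmat_ev].
Qed.

Lemma ipR_adj g h : adj (ipR mu W g h) = ipR mu W h g.
Proof.
rewrite /ipR -mint_adj; last exact: mintegrable_ip.
by congr mint; apply/funext => t; rewrite !adjM adjK adjW mulmxA.
Qed.

Lemma ipRD g h1 h2 : ipR mu W g (h1 + h2) = ipR mu W g h1 + ipR mu W g h2.
Proof.
rewrite /ipR -mintD; try exact: mintegrable_ip.
by congr mint; apply/funext => t; rewrite -mulmxDr; congr (_ *m _); exact: evD.
Qed.

Lemma ipRMC g h c : ipR mu W g (h * c%:P) = ipR mu W g h *m c.
Proof.
rewrite /ipR -mint_mulr; last exact: mintegrable_ip.
congr mint; apply/funext => t; rewrite -[RHS]mulmxA; congr (_ *m _).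
by rewrite /mpoly_at -/(ev _ _) evM evC.
Qed.

Lemma ipRN g h : ipR mu W g (- h) = - ipR mu W g h.
Proof.
rewrite -mulrN1 -[-1](polyCN 1) ipRMC.
by rewrite mulmxN mulmx1.
Qed.

Lemma ipRB g h1 h2 : ipR mu W g (h1 - h2) = ipR mu W g h1 - ipR mu W g h2.
Proof. by rewrite ipRD ipRN. Qed.

Lemma ipRDl g1 g2 h : ipR mu W (g1 + g2) h = ipR mu W g1 h + ipR mu W g2 h.
Proof. by rewrite -ipR_adj ipRD adjD !ipR_adj. Qed.

Lemma ipRMCl g h c : ipR mu W (g * c%:P) h = adj c *m ipR mu W g h.
Proof. by rewrite -ipR_adj ipRMC adjM ipR_adj. Qed.

Lemma ipR0 g : ipR mu W g 0 = 0.
Proof. by rewrite -(subrr 0) ipRB subrr. Qed.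

(* Reversal exchanges the left and the right inner products. *)
Lemma ipR_star n g h : (size g <= n.+1)%N -> (size h <= n.+1)%N ->
  ipR mu W (star n g) (star n h) = ipL mu W h g.
Proof.
move=> gn hn; congr mint; apply/funext => t.
rewrite /mpoly_at -!/(ev _ _) !ev_star_circle // adjZ adjK.
rewrite -!scalemxAl -scalemxAr scalerA rmorphXn /= conj_expi -exprMn.
by rewrite mulVf ?expi_neq0 // expr1n scale1r.
Qed.

Lemma ipR_XX g h : ipR mu W ('X * g) ('X * h) = ipR mu W g h.
Proof.
congr mint; apply/funext => t.
rewrite /mpoly_at -!/(ev _ _) !evXM adjZ.
rewrite -!scalemxAl -scalemxAr scalerA conj_expi.
by rewrite mulVf ?expi_neq0 // scale1r.
Qed.

Lemma size_le_coef0 m q : (size q <= m.+1)%N -> q`_m = 0 -> (size q <= m)%N.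
Proof.
move=> /leq_sizeP qm q0; apply/leq_sizeP => j; rewrite leq_eqVlt => /orP[/eqP <- //|].
exact: qm.
Qed.

(** One step of the expansion of q in a basis of polynomials with invertible leading
    coefficients. *)
Lemma size_cancel_lead m p q : size p = m.+1 -> lead_coef p \in unitmx ->
  (size q <= m.+1)%N -> exists c, (size (q - p * c%:P)%R <= m)%N.
Proof.
move=> pm up qm; exists (invmx (lead_coef p) *m q`_m).
apply: size_le_coef0.
  rewrite (leq_trans (size_polyD _ _)) // geq_max qm size_polyN.
  by rewrite (leq_trans (size_polyMleq _ _)) // pm addSn /= -[m.+1]addn1 leq_add2l size_polyC_leq1.
have -> : lead_coef p = p`_m by rewrite lead_coefE pm.
rewrite lead_coefE pm in up.
by rewrite coefB coefMC -mulmxE mulmxA mulmxV // mul1mx subrr.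
Qed.

Section Orthogonality.
Variable phi : nat -> {poly Md}.
Hypothesis Hphi : is_ONP_R mu W phi.

Lemma size_onpR i : size (phi i) = i.+1.
Proof. by case: Hphi => _ [/(_ i)[]]. Qed.

Lemma lead_onpR i : lead_coef (phi i) \in unitmx.
Proof. by case: Hphi => _ [/(_ i)[]]. Qed.

Lemma onpR i l : ipR mu W (phi i) (phi l) = if i == l then 1%:M else 0.
Proof. by case: Hphi => _ [_ []]. Qed.

Lemma onpR_orth n q : (size q <= n)%N -> ipR mu W (phi n) q = 0.
Proof.
(* The induction runs on a separate bound m for the size of q, so that n stays fixed while leading
   terms are removed. *)
move: {2}(size q) (leqnn (size q)) => m; elim: m q => [|m IH] q qm qn.
  by move: qm; rewrite leqn0 size_poly_eq0 => /eqP ->; exact: ipR0.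
have [qm'|mq] := leqP (size q) m; first exact: IH.
have mn : (m < n)%N := leq_trans mq qn.
have [c sc] := size_cancel_lead (size_onpR m) (lead_onpR m) qm.
rewrite -[q](subrK (phi m * c%:P)) ipRD ipRMC onpR gtn_eqF // mul0mx addr0.
by apply: IH => //; exact: leq_trans sc (ltnW mn).
Qed.

Lemma onpR_orthl n q : (size q <= n)%N -> ipR mu W q (phi n) = 0.
Proof. by move=> qn; rewrite -ipR_adj onpR_orth // adj0. Qed.

(** The inner product with the top [phi] reads off the top coefficient of the expansion of q, so the
    coefficients vanish one after the other. *)
Lemma onpR_eq0 m q : (size q <= m)%N ->
  (forall i, (i < m)%N -> ipR mu W (phi i) q = 0) -> q = 0.
Proof.
elim: m q => [|m IH] q qm q0.
  by move: qm; rewrite leqn0 size_poly_eq0 => /eqP.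
have [c sc] := size_cancel_lead (size_onpR m) (lead_onpR m) qm.
have c0 : c = 0.
  have := onpR_orth sc; rewrite ipRB ipRMC onpR eqxx mul1mx q0 // sub0r.
  by move/eqP; rewrite oppr_eq0 => /eqP.
apply: IH => [|i im]; last by apply: q0; exact: ltnW.
by move: sc; rewrite c0 mulr0 subr0.
Qed.

End Orthogonality.
End OneSided.

Lemma is_matrix_measure_tr (W : R -> Md) :
  is_matrix_measure mu W -> is_matrix_measure mu (fun t => (W t)^T).
Proof.
move=> [pW [iW W1]]; split; first by move=> t; exact: psd_tr.
split; first exact: (mintegrable_tr iW).
by rewrite mint_tr W1 trmx1.
Qed.

Lemma ipR_trp (W : R -> Md) g h :
  ipR mu (fun t => (W t)^T) (trp g) (trp h) = (ipL mu W g h)^T.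
Proof.
rewrite /ipL -mint_tr; congr mint; apply/funext => t.
by rewrite /mpoly_at -!/(ev _ _) !ev_trp adj_tr !trmx_mul mulmxA.
Qed.

Lemma ipL_trp (W : R -> Md) g h :
  ipL mu (fun t => (W t)^T) (trp g) (trp h) = (ipR mu W g h)^T.
Proof.
rewrite /ipR -mint_tr; congr mint; apply/funext => t.
by rewrite /mpoly_at -!/(ev _ _) !ev_trp adj_tr !trmx_mul mulmxA.
Qed.

Lemma is_ONP_R_tr (W : R -> Md) phi : is_ONP_L mu W phi ->
  is_ONP_R mu (fun t => (W t)^T) (fun i => trp (phi i)).
Proof.
move=> [p0 [ps [po pp]]]; split; first by rewrite p0 trp1.
split; first by move=> i; rewrite size_trp lead_coef_trp unitmx_tr; exact: ps.
split; first by move=> i l; rewrite ipR_trp po; case: eqP; rewrite ?trmx1 ?trmx0.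
by move=> i; rewrite !lead_coef_trp -trmx_inv -trmx_mul; exact: posdef_tr.
Qed.

Lemma is_ONP_L_tr (W : R -> Md) phi : is_ONP_R mu W phi ->
  is_ONP_L mu (fun t => (W t)^T) (fun i => trp (phi i)).
Proof.
move=> [p0 [ps [po pp]]]; split; first by rewrite p0 trp1.
split; first by move=> i; rewrite size_trp lead_coef_trp unitmx_tr; exact: ps.
split; first by move=> i l; rewrite ipL_trp po; case: eqP; rewrite ?trmx1 ?trmx0.
by move=> i; rewrite !lead_coef_trp -trmx_inv -trmx_mul; exact: posdef_tr.
Qed.

Lemma onpL_orth (W : R -> Md) phi n q : is_matrix_measure mu W -> is_ONP_L mu W phi ->
  (size q <= n)%N -> ipL mu W q (phi n) = 0.
Proof.
move=> HW Hphi qn; apply: trmx_inj; rewrite -ipR_trp trmx0.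
have HWt := is_matrix_measure_tr HW; have Hpt := is_ONP_R_tr Hphi.
by rewrite (onpR_orthl HWt Hpt) // size_trp.
Qed.

End InnerProduct.

Section Algebra.
Variable F : numClosedFieldType.

Lemma invmx_invl n (A B : 'M[F]_n) : A \in unitmx -> B \in unitmx ->
  invmx B *m A = invmx (invmx A *m B).
Proof.
move=> uA uB; have uM : invmx A *m B \in unitmx by rewrite unitmx_mul unitmx_inv uA.
apply: (can_inj (mulmxK uM)); rewrite mulVmx //.
by rewrite -mulmxA (mulmxA A) mulmxV // mul1mx mulVmx.
Qed.

Lemma trmx_sub1M n (A B : 'M[F]_n) : (1%:M - A^T *m B^T)^T = 1%:M - B *m A.
Proof. by rewrite linearB /= trmx1 trmx_mul !trmxK. Qed.

(** Since a l^2 = a - a a' a = r^2 a, the matrix r a - a l solves a homogeneous Sylvester equation.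
    For positive definite r and l it must then be zero. *)
Lemma commutator_of_squares n (a a' r l : 'M[F]_n) :
  l *m l = 1%:M - a' *m a -> r *m r = 1%:M - a *m a' ->
  r *m (r *m a - a *m l) = - ((r *m a - a *m l) *m l).
Proof.
move=> ll rr; have e : a *m l *m l = r *m (r *m a).
  by rewrite -mulmxA ll mulmxA rr mulmxBl mulmxBr mul1mx mulmx1 mulmxA.
by rewrite mulmxBr mulmxBl e opprB [r *m (a *m l)]mulmxA.
Qed.

(** Substituting the expression of P into S1 l = S - P a gives S (1 - a' a) - P1 r a = (S l - P1 a)
    l, from which l is cancelled. *)
Lemma szego_star_step d (S S1 P P1 : {poly 'M[F]_d.+1}) (a a' r l : 'M[F]_d.+1) :
  l \in unitmx -> l *m l = 1%:M - a' *m a -> r *m a = a *m l ->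
  P = P1 * r%:P + S * a'%:P -> S = S1 * l%:P + P * a%:P ->
  S1 = S * l%:P - P1 * a%:P.
Proof.
move=> ul ll ra eP eS.
have e : S1 * l%:P = (S * l%:P - P1 * a%:P) * l%:P.
  have -> : S1 * l%:P = S - P * a%:P by rewrite [in RHS]eS addrK.
  rewrite eP mulrDl mulrBl -!mulrA -!polyCM -!mulmxE ll ra.
  by rewrite polyCB mulrBr mulr1 opprD addrCA addrC.
have := congr1 (fun p => p * (invmx l)%:P) e.
by rewrite /= -!mulrA -!polyCM -!mulmxE mulmxV // !mulr1.
Qed.

End Algebra.

Section Szego.
Variables (R : realType) (d : nat).
Local Notation C := (C R).
Local Notation Md := 'M[C]_d.+1.
Variable mu : {measure set R -> \bar R}.
Implicit Types (p q g h : {poly Md}) (c : Md) (z : C) (n : nat).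

(** The Verblunsky coefficient as a Fourier coefficient of X phi_n^R. The algebra is done with this
    inner product, which [schur_iter_alpha] identifies with the n-th Schur parameter. *)
Definition szego_coef (W : R -> Md) (phiL phiR : nat -> {poly Md}) n : Md :=
  adj (ipR mu W (star n (phiL n)) ('X * phiR n)).

Lemma adj_szego_coef W phiL phiR n : adj (szego_coef W phiL phiR n) =
  ipR mu W (star n (phiL n)) ('X * phiR n).
Proof. exact: adjK. Qed.

Lemma szego_coefE W phiL phiR n : szego_coef W phiL phiR n =
  adj (ipR mu W (star n (phiL n)) ('X * phiR n)).
Proof. by []. Qed.

Section Right.
Variables (W : R -> Md) (phiL phiR : nat -> {poly Md}).
Hypothesis HW : is_matrix_measure mu W.
Hypothesis HL : is_ONP_L mu W phiL.
Hypothesis HR : is_ONP_R mu W phiR.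
Local Notation alpha := (szego_coef W phiL phiR).

Lemma size_onpL i : size (phiL i) = i.+1.
Proof. by case: HL => _ [/(_ i)[]]. Qed.

(** Reversal turns orthogonality of phi_n^L to 1, ..., X^(n-1) into orthogonality of its reversal to
    X, ..., X^n. *)
Lemma ipR_starL n q : (size q <= n)%N -> ipR mu W (star n (phiL n)) ('X * q) = 0.
Proof.
case: n => [|n] qn.
  by move: qn; rewrite leqn0 size_poly_eq0 => /eqP ->; rewrite mulr0 ipR0.
have Xq : (size ('X * q)%R <= n.+2)%N by rewrite (leq_trans (size_polyMleq _ _)) // size_polyX.
rewrite -(starK Xq) ipR_star ?size_onpL ?size_star // starXM.
by rewrite (onpL_orth HW HL) // size_star.
Qed.

Lemma ipR_starL_self n : ipR mu W (star n (phiL n)) (star n (phiL n)) = 1%:M.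
Proof.
rewrite ipR_star ?size_onpL //.
by case: HL => _ [_ [-> _]]; rewrite eqxx.
Qed.

Lemma starL_coef0 n : (star n (phiL n))`_0 \in unitmx.
Proof.
rewrite coef_star subn0 /= adj_unitmx.
by have := size_onpL n; case: HL => _ [/(_ n)[_]]; rewrite lead_coefE => + _ => /[swap] ->.
Qed.

Lemma szegoR_ex n : exists c, 'X * phiR n =
  phiR n.+1 * (invmx (lead_coef (phiR n.+1)) *m lead_coef (phiR n))%:P +
  star n (phiL n) * c%:P.
Proof.
set K := invmx _ *m _; set S := star n (phiL n).
pose c := - (invmx S`_0 *m ((phiR n.+1)`_0 *m K)).
exists c.
have sn := size_onpR HR n; have sn1 := size_onpR HR n.+1.
pose r := 'X * phiR n - phiR n.+1 * K%:P - S * c%:P.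
suff r0 : r = 0 by apply/eqP; rewrite -subr_eq0 opprD addrA -/r r0.
have sC p (x : Md) m : (size p <= m)%N -> (size (p * x%:P)%R <= m)%N.
  move=> pm; have [->|p0] := eqVneq p 0; first by rewrite mul0r size_poly0.
  rewrite (leq_trans _ pm) // (leq_trans (size_polyMleq _ _)) //.
  by rewrite -subn1 leq_subLR addnC leq_add2r size_polyC_leq1.
have sr : (size r <= n.+1)%N.
  rewrite (leq_trans (size_polyD _ _)) // geq_max size_polyN sC ?size_star // andbT.
  apply: size_le_coef0.
    rewrite (leq_trans (size_polyD _ _)) // geq_max size_polyN sC ?sn1 // andbT.
    by rewrite (leq_trans (size_polyMleq _ _)) // size_polyX sn.
  rewrite coefB coefXM coefMC /= -mulmxE.
  have -> : (phiR n)`_n = lead_coef (phiR n) by rewrite lead_coefE sn.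
  have -> : (phiR n.+1)`_n.+1 = lead_coef (phiR n.+1) by rewrite lead_coefE sn1.
  by rewrite mulmxA mulmxV ?(lead_onpR HR) ?mul1mx ?subrr.
have rc0 : r`_0 = 0.
  rewrite 2!coefB coefXM !coefMC /= -!mulmxE /c mulmxN (mulmxA S`_0) mulmxV ?starL_coef0 //.
  by rewrite mul1mx opprK sub0r addNr.
have [q rq sq] : exists2 q, r = 'X * q & (size q <= n)%N.
  exists (\poly_(i < n) r`_i.+1); last exact: size_poly.
  apply/polyP => -[|i]; rewrite coefXM //= coef_poly; case: ltnP => // ni.
  by rewrite nth_default // (leq_trans sr).
rewrite rq; suff -> : q = 0 by rewrite mulr0.
apply: (onpR_eq0 HW HR sq) => i ni.
have si : (size (phiR i) <= n)%N by rewrite (size_onpR HR).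
have sXi : (size ('X * phiR i)%R <= n.+1)%N.
  by rewrite (leq_trans (size_polyMleq _ _)) // size_polyX.
rewrite -ipR_XX -rq 2!(ipRB HW) 2!(ipRMC HW) ipR_XX (onpR HR).
rewrite (onpR_orthl HW HR sXi) mul0mx subr0.
rewrite -(ipR_adj HW S) ipR_starL // adj0 mul0mx subr0.
by rewrite ltn_eqF.
Qed.

Lemma ipR_lincomb p q (K c P Q : Md) : ipR mu W p p = P -> ipR mu W q q = Q ->
  ipR mu W p q = 0 -> ipR mu W q p = 0 ->
  ipR mu W (p * K%:P + q * c%:P) (p * K%:P + q * c%:P) =
  adj K *m P *m K + adj c *m Q *m c.
Proof.
move=> pp qq pq qp.
have e1 : ipR mu W (p * K%:P + q * c%:P) p = adj K *m P.
  apply: etrans (ipRDl HW _ _ _) (etrans (congr2 +%R (ipRMCl HW _ _ _) (ipRMCl HW _ _ _)) _).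
  by rewrite pp qp mulmx0 addr0.
have e2 : ipR mu W (p * K%:P + q * c%:P) q = adj c *m Q.
  apply: etrans (ipRDl HW _ _ _) (etrans (congr2 +%R (ipRMCl HW _ _ _) (ipRMCl HW _ _ _)) _).
  by rewrite qq pq mulmx0 add0r.
apply: etrans (ipRD HW _ _ _) (etrans (congr2 +%R (ipRMC HW _ _ _) (ipRMC HW _ _ _)) _).
by rewrite e1 e2.
Qed.

(** The normalization of leading coefficients makes K positive definite. Comparing the norms of both
    sides of the recursion gives its square, so K is [rhoR]. *)
Lemma szegoR_aux n : let K := invmx (lead_coef (phiR n.+1)) *m lead_coef (phiR n) in
  [/\ 'X * phiR n = phiR n.+1 * K%:P + star n (phiL n) * (adj (alpha n))%:P,
      posdef K & K *m K = 1%:M - alpha n *m adj (alpha n)].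
Proof.
move=> K; have [c e] := szegoR_ex n; rewrite -/K in e.
have o1 : ipR mu W (star n (phiL n)) (phiR n.+1) = 0.
  by rewrite (onpR_orthl HW HR) // size_star.
have ce : c = adj (alpha n).
  by rewrite adj_szego_coef e (ipRD HW) 2!(ipRMC HW) o1 mul0mx add0r ipR_starL_self mul1mx.
have pK : posdef K.
  have -> : K = invmx (invmx (lead_coef (phiR n)) *m lead_coef (phiR n.+1)).
    exact: invmx_invl (lead_onpR HR n) (lead_onpR HR n.+1).
  by apply: posdef_inv; case: HR => _ [_ [_ h]]; exact: h.
split=> //; first by rewrite -ce.
have hK : adj K = K by apply: psd_herm; exact: posdef_psd.
have o2 : ipR mu W (phiR n.+1) (star n (phiL n)) = 0.
  by rewrite -(ipR_adj HW) o1 adj0.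
have : ipR mu W ('X * phiR n) ('X * phiR n) = 1%:M by rewrite ipR_XX (onpR HR) eqxx.
rewrite e (ipR_lincomb K c (onpR HR n.+1 n.+1) (ipR_starL_self n) o2 o1) eqxx.
have ca : adj c = alpha n by rewrite ce; exact: adjK.
by rewrite -ce -ca hK; move: (adj c) => c'; rewrite !mulmx1 => <-; rewrite addrK.
Qed.

Lemma rhoR_szego n :
  rhoR (alpha n) = invmx (lead_coef (phiR n.+1)) *m lead_coef (phiR n).
Proof. by have [_ pK eK] := szegoR_aux n; exact: sqrtm_posdef. Qed.

Lemma szegoR n : 'X * phiR n =
  phiR n.+1 * (rhoR (alpha n))%:P + star n (phiL n) * (adj (alpha n))%:P.
Proof. by rewrite rhoR_szego; case: (szegoR_aux n). Qed.

Lemma posdef_rhoR n : posdef (rhoR (alpha n)).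
Proof. by rewrite rhoR_szego; case: (szegoR_aux n). Qed.

Lemma sqr_rhoR n :
  rhoR (alpha n) *m rhoR (alpha n) = 1%:M - alpha n *m adj (alpha n).
Proof. by rewrite rhoR_szego; case: (szegoR_aux n). Qed.

End Right.

Section Both.
Variables (W : R -> Md) (phiL phiR : nat -> {poly Md}).
Hypothesis HW : is_matrix_measure mu W.
Hypothesis HL : is_ONP_L mu W phiL.
Hypothesis HR : is_ONP_R mu W phiR.
Local Notation alpha := (szego_coef W phiL phiR).

Lemma szego_coef_tr n :
  szego_coef (fun t => (W t)^T) (fun i => trp (phiR i)) (fun i => trp (phiL i)) n =
  (alpha n)^T.
Proof.
rewrite !szego_coefE star_trp -trpXM ipR_trp adj_tr; congr (adj _)^T.
have sX (phi : nat -> {poly Md}) : size (phi n) = n.+1 -> (size ('X * phi n)%R <= n.+2)%N.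
  by move=> e; rewrite (leq_trans (size_polyMleq _ _)) // size_polyX e.
have sL : size (phiL n) = n.+1 := size_onpL HL n.
have sR : size (phiR n) = n.+1 := size_onpR HR n.
(* The reversal of phi_n in degree n is the reversal of X phi_n in degree n+1, so both arguments can
   be reversed in the same degree. *)
rewrite -(starXM n (phiR n)) -(starXM n (phiL n)).
rewrite -[in RHS](starK (sX _ sR)) [RHS]ipR_star ?size_star ?sX //.
Qed.

Let HWt := is_matrix_measure_tr HW.
Let HLt := is_ONP_L_tr HR.
Let HRt := is_ONP_R_tr HL.

(** The right recursion of the transposed measure supplies the positive definite root of 1 -
    alpha^dag alpha, that is [rhoL]. *)
Lemma posdef_sqr_rhoR_tr n : posdef (rhoR (alpha n)^T)^T /\
  (rhoR (alpha n)^T)^T *m (rhoR (alpha n)^T)^T = 1%:M - adj (alpha n) *m alpha n.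
Proof.
have := posdef_rhoR HWt HLt HRt n; have := sqr_rhoR HWt HLt HRt n.
rewrite szego_coef_tr => e p; split; first exact: posdef_tr.
by rewrite -trmx_mul e adj_tr; exact: trmx_sub1M.
Qed.

Lemma rhoR_tr n : rhoR (alpha n)^T = (rhoL (alpha n))^T.
Proof.
by have [p e] := posdef_sqr_rhoR_tr n; rewrite (sqrtm_posdef p e : rhoL _ = _) trmxK.
Qed.

Lemma posdef_rhoL n : posdef (rhoL (alpha n)).
Proof. by have [p e] := posdef_sqr_rhoR_tr n; rewrite (sqrtm_posdef p e : rhoL _ = _). Qed.

Lemma sqr_rhoL n :
  rhoL (alpha n) *m rhoL (alpha n) = 1%:M - adj (alpha n) *m alpha n.
Proof. by have [p e] := posdef_sqr_rhoR_tr n; rewrite (sqrtm_posdef p e : rhoL _ = _). Qed.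

Lemma rho_comm n : rhoR (alpha n) *m alpha n = alpha n *m rhoL (alpha n).
Proof.
apply/eqP; rewrite -subr_eq0; apply/eqP.
apply: (sylvester_eq0 (posdef_rhoR HW HL HR n) (posdef_rhoL n)).
exact: commutator_of_squares (sqr_rhoL n) (sqr_rhoR HW HL HR n).
Qed.

Lemma szegoL n : 'X * phiL n =
  (rhoL (alpha n))%:P * phiL n.+1 + (adj (alpha n))%:P * star n (phiR n).
Proof.
have := szegoR HWt HLt HRt n; rewrite szego_coef_tr rhoR_tr star_trp.
move=> /(congr1 (@trp _ _)); rewrite trpD !trpMC trpXM !trpK => ->.
by rewrite !trmxK adj_tr trmxK.
Qed.

Lemma szego_starL n : star n (phiL n) =
  star n.+1 (phiL n.+1) * (rhoL (alpha n))%:P + 'X * phiR n * (alpha n)%:P.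
Proof.
have sR : (size (phiR n) <= n.+1)%N by rewrite (size_onpR HR).
rewrite -starXM szegoL starD !starCM adjK (star_lift (size_star n (phiR n))) (starK sR).
by rewrite psd_herm //; apply: posdef_psd; exact: posdef_rhoL.
Qed.

Lemma szego_starL_next n : star n.+1 (phiL n.+1) =
  star n (phiL n) * (rhoL (alpha n))%:P - phiR n.+1 * (alpha n)%:P.
Proof.
have uL : rhoL (alpha n) \in unitmx by apply: posdef_unitmx; exact: posdef_rhoL.
exact: szego_star_step uL (sqr_rhoL n) (rho_comm n) (szegoR HW HL HR n) (szego_starL n).
Qed.

End Both.
End Szego.

(** * Cauchy transforms *)

Section Scaling.
Variable F : numClosedFieldType.

Lemma scale_sandwichl m n p q (k x : F) (A : 'M[F]_(m, n)) (B : 'M[F]_(n, p)) (D : 'M[F]_(p, q)) :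
  k *: (x *: A *m B *m D) = (k * x) *: (A *m B *m D).
Proof. by rewrite -!scalemxAl scalerA. Qed.

Lemma scale_factor d (k x z : F) (A E Q V : 'M[F]_d.+1) : k * (x - z) = 1 ->
  k *: (A *m (E *m (x%:M - z%:M) + V)) = A *m E + k *: (A *m 1%:M) *m V.
Proof.
move=> kx; rewrite -raddfB /= mul_mx_scalar mulmxDr scalerDr -scalemxAr scalerA kx scale1r.
by rewrite mulmx1 -scalemxAl.
Qed.

Lemma scale_tfactor d (k x z : F) (A E Q V : 'M[F]_d.+1) : k * (x - z) = x ->
  k *: (A *m (E *m (x%:M - z%:M) + V)) = A *m (x *: E) + k *: (A *m 1%:M) *m V.
Proof.
move=> kx; rewrite -raddfB /= mul_mx_scalar mulmxDr scalerDr -scalemxAr scalerA kx.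
by rewrite mulmx1 -scalemxAl -scalemxAr.
Qed.

Lemma scale_factorl d (k x y z : F) (E V B P : 'M[F]_d.+1) :
  k *: ((y *: (E *m (x%:M - z%:M) + V)) *m B *m P) =
  (k * y * (x - z)) *: (E *m B *m P) + V *m ((k * y) *: (B *m P)).
Proof.
rewrite -raddfB /= mul_mx_scalar scalerDr scalerA !mulmxDl -!scalemxAl scalerDr !scalerA.
by rewrite -scalemxAr !mulmxA mulrA.
Qed.

Lemma eq_lincomb d (x x' y y' A A' B B' : 'M[F]_d.+1) :
  x = x' -> y = y' -> A = A' -> B = B' -> x *m A + y *m B = x' *m A' + y' *m B'.
Proof. by move=> -> -> -> ->. Qed.

End Scaling.

Section CauchyTransforms.
Variables (R : realType) (d : nat).
Local Notation C := (C R).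
Local Notation Md := 'M[C]_d.+1.
Variable mu : {measure set R -> \bar R}.
Implicit Types (p q g h : {poly Md}) (c : Md) (z : C) (n : nat).

Definition cauchy z (t : R) : C := (expi t - z)^-1.
Definition tcauchy z (t : R) : C := expi t / (expi t - z).

Lemma bcont_tcauchy z : `|z| < 1 -> bcont (tcauchy z).
Proof. by move=> z1; apply: bcontM; [exact: bcont_expi|exact: bcont_cauchy]. Qed.

(** With the kernels [cauchy z] and [tcauchy z], abbreviated [wsig] and [wtau], these are the blocks
    of the matrices Y and M of the overview. *)
Definition wip (k : R -> C) (W : R -> Md) g h : Md :=
  mint mu (fun t => k t *: (adj (ev g (expi t)) *m W t *m ev h (expi t))).

Section Weighted.
Variable W : R -> Md.
Hypothesis HW : is_matrix_measure mu W.
Variable k : R -> C.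
Hypothesis bk : bcont k.

Lemma mintegrable_wip g h :
  mintegrable mu (fun t => k t *: (adj (ev g (expi t)) *m W t *m ev h (expi t))).
Proof. by apply: mintegrableZ => //; exact: mintegrable_ip. Qed.

Lemma wipDl g1 g2 h : wip k W (g1 + g2) h = wip k W g1 h + wip k W g2 h.
Proof.
rewrite /wip -mintD; try exact: mintegrable_wip.
by apply: eq_mint => t; rewrite -scalerDr -!mulmxDl evD adjD.
Qed.

Lemma wipMCl g h c : wip k W (g * c%:P) h = adj c *m wip k W g h.
Proof.
rewrite /wip -mint_mull; last exact: mintegrable_wip.
apply: eq_mint => t; rewrite -scalemxAr; congr (_ *: _).
by rewrite evM evC adjM !mulmxA.
Qed.

Lemma wipNl g h : wip k W (- g) h = - wip k W g h.
Proof.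
rewrite /wip -mintN; last exact: mintegrable_wip.
by apply: eq_mint => t; rewrite evN adjN !mulNmx scalerN.
Qed.

Lemma wip_lincomb p q K c h :
  wip k W (p * K%:P + q * c%:P) h = adj K *m wip k W p h + adj c *m wip k W q h.
Proof. exact: etrans (wipDl _ _ _) (congr2 +%R (wipMCl _ _ _) (wipMCl _ _ _)). Qed.

Lemma wip_lincombB p q K c h :
  wip k W (p * K%:P - q * c%:P) h = adj K *m wip k W p h - adj c *m wip k W q h.
Proof.
apply: etrans (wipDl _ _ _) (congr2 +%R (wipMCl _ _ _) _).
exact: etrans (wipNl _ _) (congr1 _ (wipMCl _ _ _)).
Qed.

End Weighted.

Section Kernels.
Variable W : R -> Md.
Hypothesis HW : is_matrix_measure mu W.
Variable z : C.
Hypothesis z1 : `|z| < 1.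
Local Notation wsig := (wip (cauchy z) W).
Local Notation wtau := (wip (tcauchy z) W).

(** On the circle, X in the left argument contributes conj(t) = 1/t, which turns the kernel t/(t-z)
    into 1/(t-z). *)
Lemma wtauXl g h : wtau ('X * g) h = wsig g h.
Proof.
rewrite /wip; apply: eq_mint => t.
have -> : adj (ev ('X * g) (expi t)) = (expi t)^-1 *: adj (ev g (expi t)).
  by rewrite evXM adjZ conj_expi.
rewrite scale_sandwichl; congr (_ *: _).
by rewrite /tcauchy /cauchy mulrC mulrA mulVf ?expi_neq0 // mul1r.
Qed.

Lemma wtau_wsig g h : wtau g h = ipR mu W g h + z *: wsig g h.
Proof.
have iw := mintegrable_wip HW (bcont_cauchy z1) g h.
rewrite /wip -mintZ // -mintD; last first.
- exact: mintegrableZ (bcont_cst z) iw.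
- exact: mintegrable_ip.
have e t : tcauchy z t = 1 + z * cauchy z t.
  by rewrite /tcauchy /cauchy -[1](mulfV (expi_subz_neq0 t z1)) -mulrDl subrK.
by apply: eq_mint => t; rewrite e scalerDl scale1r scalerA.
Qed.

(** Insert q(t) = q1(t) (t-z) + q(z). The kernel cancels in the first part and leaves an ordinary
    inner product, to be killed by orthogonality. *)
Lemma wsig_factor g q : exists2 q1 : {poly Md}, (size q1 <= (size q).-1)%N &
  wsig g q = ipR mu W g q1 + wsig g 1 *m ev q z.
Proof.
have [q1 sq1 e] := ev_factor_at q z; exists q1 => //.
have iw h := mintegrable_wip HW (bcont_cauchy z1) g h.
rewrite /wip -mint_mulr // /ipR -mintD; first last.
- exact: mintegrable_mulr (bmat_cst _) (iw _).
- exact: mintegrable_ip.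
apply: eq_mint => t; rewrite (e (expi t)) (evC 1).
apply: (scale_factor (adj (ev g (expi t)) *m W t) (ev q1 (expi t)) (ev q z)).
by rewrite /cauchy mulVf // expi_subz_neq0.
Qed.

Lemma wtau_factor g q : exists2 q1 : {poly Md}, (size q1 <= (size q).-1)%N &
  wtau g q = ipR mu W g ('X * q1) + wtau g 1 *m ev q z.
Proof.
have [q1 sq1 e] := ev_factor_at q z; exists q1 => //.
have iw h := mintegrable_wip HW (bcont_tcauchy z1) g h.
rewrite /wip -mint_mulr // /ipR -mintD; first last.
- exact: mintegrable_mulr (bmat_cst _) (iw _).
- exact: mintegrable_ip.
apply: eq_mint => t.
rewrite [mpoly_at ('X * q1) t](evXM q1) (e (expi t)) (evC 1).
apply: (scale_tfactor (adj (ev g (expi t)) *m W t) (ev q1 (expi t)) (ev q z)).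
by rewrite /tcauchy mulfVK // expi_subz_neq0.
Qed.

End Kernels.

Section Right.
Variables (W : R -> Md) (phiL phiR : nat -> {poly Md}).
Hypothesis HW : is_matrix_measure mu W.
Hypothesis HL : is_ONP_L mu W phiL.
Hypothesis HR : is_ONP_R mu W phiR.
Local Notation alpha := (szego_coef mu W phiL phiR).
Variable z : C.
Hypothesis z1 : `|z| < 1.
Local Notation wsig := (wip (cauchy z) W).
Local Notation wtau := (wip (tcauchy z) W).
Local Notation starL n := (star n (phiL n)).

Lemma wsig_onp n q : (size q <= n.+1)%N -> wsig (phiR n) q = wsig (phiR n) 1 *m ev q z.
Proof.
move=> qn; have [q1 sq ->] := wsig_factor HW z1 (phiR n) q.
rewrite (onpR_orth HW HR) ?add0r // (leq_trans sq) // -ltnS.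
by case: (size q) qn.
Qed.

Lemma wtau_starL n q : (size q <= n.+1)%N ->
  wtau (starL n) q = wtau (starL n) 1 *m ev q z.
Proof.
move=> qn; have [q1 sq ->] := wtau_factor HW z1 (starL n) q.
rewrite (ipR_starL HW HL) ?add0r // (leq_trans sq) // -ltnS.
by case: (size q) qn.
Qed.

(* [wtau (starL n) (starL n)] is the Cauchy integral of a normalized psd measure, hence invertible,
   and it factors through [wtau_starL]. *)
Lemma wtau_starL_unit n :
  wtau (starL n) 1 \in unitmx /\ ev (starL n) z \in unitmx.
Proof.
have : wtau (starL n) (starL n) \in unitmx.
  apply: cauchy_integral_unit => //.
  - by move=> t; apply: psd_congr; case: HW.
  - exact: mintegrable_ip.
  - exact: ipR_starL_self HL n.
by rewrite (wtau_starL (size_star n (phiL n))) unitmx_mul => /andP[].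
Qed.

(* The quotient (q(t) - q(z)) / (t - z), times t^(1-j), is the adjoint of a polynomial of degree < j
   on the circle, hence is orthogonal to [phiR s]. *)
Lemma wtau_star_onp j s q : (size q <= j.+1)%N -> (j <= s)%N ->
  wtau (star j q) (phiR s) =
  ev q z *m mint mu (fun t => (tcauchy z t / expi t ^+ j) *: (W t *m ev (phiR s) (expi t))).
Proof.
move=> qj js; have [q1 sq1 e] := ev_factor_at q z.
have bt : bcont (fun t => tcauchy z t / expi t ^+ j).
  by apply: bcontM; [exact: bcont_tcauchy|exact: bcontV_expiX].
have iW : mintegrable mu (fun t => W t *m ev (phiR s) (expi t)).
  by apply: mintegrable_mulr; [exact: bmat_ev|exact: mintegrableW].
have iK := mintegrableZ bt iW.
have sj : (size q1 <= j)%N by rewrite (leq_trans sq1) //; case: (size q) qj.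
have iE : mintegrable mu (fun t => ev q1 (expi t) *m W t *m ev (phiR s) (expi t)).
  by apply: mintegrable_sandwich => //; exact: bmat_ev.
have bE : bcont (fun t => tcauchy z t / expi t ^+ j * (expi t - z)).
  by apply: bcontM => //; apply: bcontD; [exact: bcont_expi|exact: bcont_cst].
have I1 : mint mu (fun t => (tcauchy z t / expi t ^+ j * (expi t - z)) *:
    (ev q1 (expi t) *m W t *m ev (phiR s) (expi t))) = 0.
  (* For j = 0 the polynomial q is constant and q1 = 0. Otherwise t^(1-j) q1(t) is, on the circle,
     the adjoint of the reversal of q1 in degree j-1. *)
  case: j => [|j] in qj js sj {bt iK bE} *.
    move: sj; rewrite leqn0 size_poly_eq0 => /eqP ->; rewrite -[RHS](mint0 mu).
    by apply: eq_mint => t; rewrite [ev 0 _]horner0 !mul0mx scaler0.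
  transitivity (ipR mu W (star j q1) (phiR s)); last first.
    by rewrite (onpR_orthl HW HR) // (leq_trans (size_star j q1)).
  apply: eq_mint => t.
  have -> : adj (mpoly_at (star j q1) t) = (expi t ^+ j)^-1 *: ev q1 (expi t).
    by rewrite [mpoly_at _ _]ev_star_circle // adjZ adjK rmorphXn /= conj_expi exprVn.
  have := scale_sandwichl 1 (expi t ^+ j)^-1 (ev q1 (expi t)) (W t) (ev (phiR s) (expi t)).
  rewrite scale1r mul1r => ->; congr (_ *: _).
  have tz := expi_subz_neq0 t z1; have t0 : expi t != 0 :> C := expi_neq0 t.
  by rewrite /tcauchy mulrAC mulfVK // exprS invfM mulrA mulfV // mul1r.
rewrite -mint_mull // -[RHS]add0r -I1 -mintD; first last.
- exact: mintegrable_mull (bmat_cst _) iK.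
- exact: mintegrableZ.
apply: eq_mint => t.
have -> : adj (ev (star j q) (expi t)) = (expi t ^+ j)^-1 *: ev q (expi t).
  by rewrite ev_star_circle // adjZ adjK rmorphXn /= conj_expi exprVn.
rewrite (e (expi t)); exact: scale_factorl.
Qed.

Lemma rhoR_herm n : adj (rhoR (alpha n)) = rhoR (alpha n).
Proof. by apply: psd_herm; apply: posdef_psd; exact: posdef_rhoR. Qed.

Lemma rhoL_herm n : adj (rhoL (alpha n)) = rhoL (alpha n).
Proof. by apply: psd_herm; apply: posdef_psd; exact: posdef_rhoL. Qed.

Lemma wtau_szego n h :
  wsig (phiR n) h = rhoR (alpha n) *m wtau (phiR n.+1) h + alpha n *m wtau (starL n) h.
Proof.
apply: etrans (esym (wtauXl W z _ _)) _.
apply: etrans (congr1 (fun p => wtau p h) (szegoR HW HL HR n)) _.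
apply: etrans (wip_lincomb HW (bcont_tcauchy z1) _ _ _ _ _) _.
exact: eq_lincomb (rhoR_herm n) (adjK _) erefl erefl.
Qed.

Lemma wtau_starL_prev n h :
  wtau (starL n) h = rhoL (alpha n) *m wtau (starL n.+1) h + adj (alpha n) *m wsig (phiR n) h.
Proof.
apply: etrans (congr1 (fun p => wtau p h) (szego_starL HW HL HR n)) _.
apply: etrans (wip_lincomb HW (bcont_tcauchy z1) _ _ _ _ _) _.
exact: eq_lincomb (rhoL_herm n) erefl erefl (wtauXl W z _ _).
Qed.

Lemma wtau_starL_next n h :
  wtau (starL n.+1) h = rhoL (alpha n) *m wtau (starL n) h - adj (alpha n) *m wtau (phiR n.+1) h.
Proof.
apply: etrans (congr1 (fun p => wtau p h) (szego_starL_next HW HL HR n)) _.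
apply: etrans (wip_lincombB HW (bcont_tcauchy z1) _ _ _ _ _) _.
by rewrite rhoL_herm.
Qed.

(** As phi_{n+1}^R is orthogonal to 1, its two Cauchy transforms differ by the factor z. This is the
    source of the division by z in the Schur algorithm. *)
Lemma wsig_onp_step n :
  z *: (rhoR (alpha n) *m wsig (phiR n.+1) 1) = wsig (phiR n) 1 - alpha n *m wtau (starL n) 1.
Proof.
have o : ipR mu W (phiR n.+1) 1 = 0.
  by rewrite (onpR_orth HW HR) // size_poly1.
have e := wtau_wsig HW z1 (phiR n.+1) 1; rewrite o add0r in e.
by rewrite (wtau_szego n 1) addrK e scalemxAr.
Qed.

End Right.
End CauchyTransforms.

(** * Block matrices and compressed measures *)

Section Blocks.
Variables (R : realType) (d : nat).
Local Notation C := (C R).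
Local Notation Md := 'M[C]_d.+1.
Implicit Types (F G : nat -> nat -> Md).

Lemma sum_blocks (V : nmodType) N D (f : nat -> 'I_D.+1 -> V) :
  \sum_(q < N * D.+1) f (q %/ D.+1)%N (inord (q %% D.+1)) =
  \sum_(u < N) \sum_(e < D.+1) f u e.
Proof.
elim: N => [|N IH]; first by rewrite !big_ord0.
rewrite [RHS]big_ord_recr /= -IH -!(big_mkord xpredT (fun q => f (q %/ D.+1)%N (inord (q %% D.+1)))).
rewrite (@big_cat_nat _ _ _ (N * D.+1)) //=; last by rewrite leq_mul2r leqnSn orbT.
congr (_ + _); rewrite -{1}[(N * D.+1)%N]add0n big_addn mulSn addnK big_mkord.
apply: eq_bigr => e _; rewrite addnC divnMDl // divn_small // addn0.
by rewrite modnMDl modn_small // inord_val.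
Qed.

Lemma blkM N F G : blk N F *m blk N G =
  blk N (fun r s => \sum_(u < N) F r u *m G u s).
Proof.
apply/matrixP => p q; rewrite !mxE summxE.
under eq_bigr do rewrite !mxE.
rewrite (sum_blocks N (fun u e => F (p %/ d.+1)%N u (inord (p %% d.+1)) e *
  G u (q %/ d.+1)%N e (inord (q %% d.+1)))).
by apply: eq_bigr => u _; rewrite mxE.
Qed.

Lemma eq_blk N F G : (forall r s, (r < N)%N -> (s < N)%N -> F r s = G r s) ->
  blk N F = blk N G.
Proof.
move=> FG; apply/matrixP => p q; rewrite !mxE FG //.
  by rewrite ltn_divLR //; exact: ltn_ord.
by rewrite ltn_divLR //; exact: ltn_ord.
Qed.

Lemma adj_blk N F : adj (blk N F) = blk N (fun r s => adj (F s r)).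
Proof. by apply/matrixP => p q; rewrite !(adjE, mxE). Qed.

Lemma tr_blk N F : (blk N F)^T = blk N (fun r s => (F s r)^T).
Proof. by apply/matrixP => p q; rewrite !mxE. Qed.

Lemma blk1 N : blk N (fun r s => if r == s then 1%:M else 0 : Md) = 1%:M.
Proof.
apply/matrixP => p q; rewrite !mxE -val_eqE /=.
rewrite [in RHS](divn_eq p d.+1) [in RHS](divn_eq q d.+1).
case: eqP => [->|ne]; rewrite !mxE; last first.
  case: eqP => // e; case: ne; rewrite -(divn_eq p) -(divn_eq q) in e.
  by rewrite e.
by rewrite eqn_add2l -val_eqE /= !inordK // ltn_mod.
Qed.

Lemma mint_blk (mu : {measure set R -> \bar R}) N (F : R -> nat -> nat -> Md) :
  mint mu (fun t => blk N (F t)) = blk N (fun r s => mint mu (fun t => F t r s)).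
Proof.
apply/matrixP => p q; rewrite !mxE; congr cint; apply/funext => t.
by rewrite !mxE.
Qed.

Lemma scale_blk N (x : C) F : x *: blk N F = blk N (fun r s => x *: F r s).
Proof. by apply/matrixP => p q; rewrite !mxE. Qed.

Section ThetaSweep.
Variables (N : nat) (Y Z M : nat -> nat -> Md) (a : nat -> Md).

(* Column of integrals after the first m factors Theta^dag: rows below m are final, row m is the pending
   reversed polynomial, rows above m are untouched. *)
Definition sweep m : 'M[C]_(N.+1 * d.+1) := blk N.+1 (fun r s =>
  if (r < m)%N then Y r s else if r == m then Z r s else M r s).

Hypothesis hL : forall i, adj (rhoL (a i)) = rhoL (a i).
Hypothesis hR : forall i, adj (rhoR (a i)) = rhoR (a i).
Hypothesis eY : forall i s, (i < N)%N -> (s <= N)%N ->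
  Y i s = rhoR (a i) *m M i.+1 s + a i *m Z i s.
Hypothesis eZ : forall i s, (i < N)%N -> (s <= N)%N ->
  Z i.+1 s = rhoL (a i) *m Z i s - adj (a i) *m M i.+1 s.

Lemma sum_two n (i : nat) (f : nat -> Md) : (i.+1 < n)%N ->
  (forall u, (u < n)%N -> u != i -> u != i.+1 -> f u = 0) ->
  \sum_(u < n) f u = f i + f i.+1.
Proof.
move=> iN f0; have iN' : (i < n)%N by exact: ltnW.
rewrite (bigD1 (Ordinal iN')) //= (bigD1 (Ordinal iN)) /=; last first.
  by rewrite -val_eqE /= gtn_eqF.
rewrite big1 ?addr0 // => u /andP[]; rewrite -!val_eqE /= => u1 u2.
exact: f0.
Qed.

Lemma sum_one n (i : nat) (f : nat -> Md) : (i < n)%N ->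
  (forall u, (u < n)%N -> u != i -> f u = 0) -> \sum_(u < n) f u = f i.
Proof.
move=> iN f0; rewrite (bigD1 (Ordinal iN)) //= big1 ?addr0 // => u.
by rewrite -val_eqE /=; exact: f0.
Qed.

(** Only the block rows i and i+1 of the factor differ from the identity; their action is given by
    [eY] and [eZ]. *)
Lemma Theta_sweep i : (i < N)%N -> adj (Theta N i (a i)) *m sweep i = sweep i.+1.
Proof.
move=> iN; rewrite adj_blk blkM; apply: eq_blk => r s rN sN.
have n1 : (i.+1 == i) = false by rewrite gtn_eqF.
have n2 : (i == i.+1) = false by rewrite ltn_eqF.
have n3 : (i.+1 < i)%N = false by rewrite ltnNge leqnSn.
(* [th u] is the block (u, r) of Theta, whose adjoint is the block (r, u) of the factor. *)
pose th u := if (u == i) && (r == i) then adj (a i)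
    else if (u == i) && (r == i.+1) then rhoL (a i)
    else if (u == i.+1) && (r == i) then rhoR (a i)
    else if (u == i.+1) && (r == i.+1) then - a i
    else if u == r then 1%:M else 0.
pose f u := adj (th u) *m (if (u < i)%N then Y u s else if u == i then Z u s else M u s).
rewrite -[LHS]/(\sum_(u < N.+1) f u).
have [e|ri] := eqVneq r i.
  rewrite (@sum_two _ i f) //; last first.
    by move=> u _ /negPf u1 /negPf u2; rewrite /f /th e u1 u2 adj0 mul0mx.
  by rewrite /f /th e !eqxx n1 n3 ltnn ltnSn /= adjK hR eY // addrC.
have [e|ri1] := eqVneq r i.+1.
  rewrite (@sum_two _ i f) //; last first.
    by move=> u _ /negPf u1 /negPf u2; rewrite /f /th e u1 u2 adj0 mul0mx.
  by rewrite /f /th e !eqxx n1 n2 n3 !ltnn /= adjN hL mulNmx eZ.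
rewrite (@sum_one _ r f) //.
  have -> : (r < i.+1)%N = (r < i)%N by rewrite ltnS leq_eqVlt (negPf ri).
  by rewrite /f /th (negPf ri) (negPf ri1) !andbF eqxx adj1 mul1mx.
move=> u _ ur; rewrite /f /th (negPf ri) (negPf ri1) !andbF (negPf ur).
by rewrite adj0 mul0mx.
Qed.

(** The adjoint reverses the product, so the factor of index m acts first. The starting index is
    kept variable for the induction. *)
Lemma Hess_sweep m n : (m + n <= N)%N ->
  adj (foldr (fun i A => Theta N i (a i) *m A) 1%:M (iota m n)) *m sweep m = sweep (m + n).
Proof.
elim: n m => [|n IH] m mn /=; first by rewrite adj1 mul1mx addn0.
have mN : (m < N)%N by rewrite (leq_trans _ mn) // addnS ltnS leq_addr.
by rewrite adjM -mulmxA Theta_sweep // IH addSnnS.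
Qed.

End ThetaSweep.
Section Compression.
Variable mu : {measure set R -> \bar R}.

Lemma tcauchy_integral n (V : R -> 'M[C]_n) (z : C) : mintegrable mu V -> `|z| < 1 ->
  mint mu (fun t => tcauchy z t *: V t) = mint mu V + z *: mint mu (fun t => cauchy z t *: V t).
Proof.
move=> iV z1; have iw := mintegrableZ (bcont_cauchy z1) iV.
have iz : mintegrable mu (fun t => z *: ((expi t - z)^-1 *: V t)).
  by have := mintegrableZ (bcont_cst z) iw.
rewrite -mintZ // -mintD //; apply: eq_mint => t.
have e : tcauchy z t = 1 + z * cauchy z t.
  by rewrite /tcauchy /cauchy -[1](mulfV (expi_subz_neq0 t z1)) -mulrDl subrK.
by rewrite e scalerDl scale1r scalerA.
Qed.

Lemma invmx_scale2 n (A B : 'M[C]_n) : B \in unitmx ->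
  (2 *: A) *m invmx (2 *: B) = A *m invmx B.
Proof.
move=> uB; have n2 : (2 : C) != 0 by rewrite pnatr_eq0.
rewrite invmxZ ?unitmxZ ?unitfE //.
by rewrite -scalemxAl -scalemxAr scalerA mulfV // scale1r.
Qed.

(** As the total mass is 1 and (t+z)/(t-z) + 1 = 2 t/(t-z), one has F + 1 = 2 M, and the factor 2
    cancels against that of z^-1 (F - 1) = 2 Y. *)
Lemma schur_funE n (V : R -> 'M[C]_n) (z : C) : is_matrix_measure mu V -> `|z| < 1 ->
  schur_fun mu V z = mint mu (fun t => cauchy z t *: V t) *m
    invmx (mint mu (fun t => tcauchy z t *: V t)).
Proof.
move=> [pV [iV V1]] z1.
have iw := mintegrableZ (bcont_cauchy z1) iV.
have iv := mintegrableZ (bcont_tcauchy z1) iV.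
have uM := cauchy_integral_unit z1 pV iV V1.
rewrite -(invmx_scale2 _ uM) /schur_fun; congr (_ *m invmx _).
  by rewrite -mintZ //; apply: eq_mint => t; rewrite scalerA.
rewrite -V1 /caratheodory -mintD //; last first.
  have := mintegrableZ (bcontM (bcontD (@bcont_expi R) (bcont_cst z)) (bcont_cauchy z1)) iV.
  by [].
rewrite -mintZ //; apply: eq_mint => t; rewrite scalerA.
have tz := expi_subz_neq0 t z1.
have -> : 2 * tcauchy z t = (expi t + z) / (expi t - z) + 1 by rewrite /tcauchy; field.
by rewrite scalerDl scale1r.
Qed.

Lemma schur_funP n (V : R -> 'M[C]_n) (z : C) (H : 'M[C]_n) :
  is_matrix_measure mu V -> `|z| < 1 ->
  mint mu (fun t => cauchy z t *: V t) = H *m mint mu (fun t => tcauchy z t *: V t) ->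
  schur_fun mu V z = H.
Proof.
move=> HV z1 e; rewrite schur_funE // e mulmxK //.
by case: HV => pV [iV V1]; exact: cauchy_integral_unit z1 pV iV V1.
Qed.

(** M = 1 + z Y commutes with Y, so the quotient is the same on either side and survives
    transposition. *)
Lemma schur_fun_tr n (V : R -> 'M[C]_n) (z : C) : is_matrix_measure mu V -> `|z| < 1 ->
  schur_fun mu (fun t => (V t)^T) z = (schur_fun mu V z)^T.
Proof.
move=> HV z1; have HVt : is_matrix_measure mu (fun t => (V t)^T).
  case: HV => pV [iV V1]; split; first by move=> t; exact: psd_tr.
  by split; [exact: mintegrable_tr iV|rewrite mint_tr V1 trmx1].
have trZ (k : R -> C) : mint mu (fun t => k t *: (V t)^T) = (mint mu (fun t => k t *: V t))^T.
  by rewrite -mint_tr; apply: eq_mint => t; rewrite linearZ.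
apply: schur_funP => //; rewrite !trZ schur_funE //.
case: HV => pV [iV V1]; have uM := cauchy_integral_unit z1 pV iV V1.
rewrite -trmx_mul tcauchy_integral // V1 in uM *.
move: uM; set Y := mint mu _ => uM.
have cY : Y *m (1%:M + z *: Y) = (1%:M + z *: Y) *m Y.
  by rewrite mulmxDl mulmxDr mul1mx mulmx1 -scalemxAl -scalemxAr.
by rewrite mulmxA -cY mulmxK.
Qed.

End Compression.
End Blocks.

(** * Schur function of the right compressed measure *)

Section Compression.
Variables (R : realType) (d : nat).
Local Notation C := (C R).
Local Notation Md := 'M[C]_d.+1.
Variable mu : {measure set R -> \bar R}.
Variables (W : R -> Md) (phiL phiR : nat -> {poly Md}).
Hypothesis HW : is_matrix_measure mu W.
Hypothesis HL : is_ONP_L mu W phiL.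
Hypothesis HR : is_ONP_R mu W phiR.
Local Notation alpha := (szego_coef mu W phiL phiR).
Variables j k : nat.
Hypothesis Hjk : (j <= k)%N.
Local Notation N := (k - j)%N.

Lemma PhiR_sandwich t : adj (PhiR phiR j k t) *m W t *m PhiR phiR j k t =
  blk N.+1 (fun r s =>
    adj (ev (phiR (j + r)%N) (expi t)) *m W t *m ev (phiR (j + s)%N) (expi t)).
Proof.
apply/matrixP => p q; rewrite !mxE; apply: eq_bigr => b _.
rewrite !mxE; congr (_ * _); apply: eq_bigr => a _.
by rewrite !(adjE, mxE).
Qed.

Lemma bmat_PhiR : bmat (PhiR phiR j k).
Proof. by move=> a c; under eq_fun do rewrite mxE; exact: bmat_ev. Qed.

Lemma PhiR_matrix_measure :
  is_matrix_measure mu (fun t => adj (PhiR phiR j k t) *m W t *m PhiR phiR j k t).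
Proof.
split; first by move=> t; apply: psd_congr; case: HW.
split; first exact: (mintegrable_sandwich HW (bmat_adj bmat_PhiR) bmat_PhiR).
rewrite (eq_mint mu PhiR_sandwich) mint_blk -blk1; apply: eq_blk => r s _ _.
by apply: etrans (onpR HR (j + r) (j + s)) _; rewrite eqn_add2l.
Qed.

Lemma mint_PhiR (h : R -> C) :
  mint mu (fun t => h t *: (adj (PhiR phiR j k t) *m W t *m PhiR phiR j k t)) =
  blk N.+1 (fun r s => wip mu h W (phiR (j + r)%N) (phiR (j + s)%N)).
Proof.
rewrite -mint_blk; apply: eq_mint => t.
by rewrite PhiR_sandwich scale_blk.
Qed.

Definition blkdiag n i (X : Md) : 'M[C]_(n.+1 * d.+1) :=
  blk n.+1 (fun r s => if r == s then (if r == i then X else 1%:M) else 0).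

Lemma blkdiagM n i X F : blkdiag n i X *m blk n.+1 F =
  blk n.+1 (fun r s => if r == i then X *m F r s else F r s).
Proof.
rewrite blkM; apply: eq_blk => r s rn sn.
rewrite (@sum_one _ _ _ r (fun u => (if r == u then (if r == i then X else 1%:M) else 0) *m F u s)) //.
  by rewrite eqxx; case: eqP => // _; rewrite mul1mx.
by move=> u _ /negPf; rewrite eq_sym => ->; rewrite mul0mx.
Qed.

Variable z : C.
Hypothesis z1 : `|z| < 1.
Variables fk bj : Md.
Hypothesis Hf : fk *m wip mu (tcauchy z) W (star k (phiL k)) 1 = wip mu (cauchy z) W (phiR k) 1.
Hypothesis Hb : bj *m ev (star j (phiR j)) z = ev (phiL j) z.

Lemma schur_fun_PhiR :
  schur_fun mu (fun t => adj (PhiR phiR j k t) *m W t *m PhiR phiR j k t) z =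
  blkdiag N N fk *m adj (Hess N (fun i => alpha (j + i)%N)) *m blkdiag N 0 bj.
Proof.
apply: schur_funP => //; first exact: PhiR_matrix_measure.
rewrite !mint_PhiR.
(* Y and M are the blocks of the overview; Z has the reversed left polynomials in place of the right
   ones. *)
pose Y r s := wip mu (cauchy z) W (phiR (j + r)%N) (phiR (j + s)%N).
pose M r s := wip mu (tcauchy z) W (phiR (j + r)%N) (phiR (j + s)%N).
pose Z r s := wip mu (tcauchy z) W (star (j + r) (phiL (j + r)%N)) (phiR (j + s)%N).
have eY i s : (i < N)%N -> (s <= N)%N ->
    Y i s = rhoR (alpha (j + i)%N) *m M i.+1 s + alpha (j + i)%N *m Z i s.
  by move=> _ _; rewrite /Y /M /Z addnS; exact: wtau_szego.
have eZ i s : (i < N)%N -> (s <= N)%N ->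
    Z i.+1 s = rhoL (alpha (j + i)%N) *m Z i s - adj (alpha (j + i)%N) *m M i.+1 s.
  by move=> _ _; rewrite /M /Z addnS; exact: wtau_starL_next.
have hL i := rhoL_herm HW HL HR (j + i); have hR i := rhoR_herm HW HL HR (j + i).
have hess := Hess_sweep hL hR eY eZ (leqnn (0 + N)).
have e0 : blkdiag N 0 bj *m blk N.+1 M = sweep N Y Z M 0.
  apply: etrans (blkdiagM N 0 bj M) _; 
  rewrite /sweep; apply: (@eq_blk R d N.+1).
  move=> r s _ _.
  case: (eqVneq r 0%N) => [e|r0]; last first.
    rewrite ltn0.
    reflexivity.
  rewrite e ltnn.
  (* Writing phi_j^R as the reversal of its reversal lets [wtau_star_onp] pull out phi_j^{R,*}(z).
     Row 0 of Z has phi_j^L(z) times the same integral, and b_j converts one into the other. *)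
  rewrite /M /Z addn0 -{1}(starK (eq_leq (size_onpR HR j))).
  have sj := size_star j (phiR j); have sL := eq_leq (size_onpL HL j).
  rewrite (wtau_star_onp HW HR z1 sj (leq_addr s j)) mulmxA Hb.
  by rewrite (wtau_star_onp HW HR z1 sL (leq_addr s j)).
have eN : blkdiag N N fk *m sweep N Y Z M N = blk N.+1 Y.
  apply: etrans (blkdiagM N N fk _) _; apply: eq_blk => r s rN sN.
  case: eqP => [->|/eqP ne]; last first.
    have -> : (r < N)%N by rewrite ltn_neqAle ne -ltnS.
    reflexivity.
  rewrite ltnn /Y /Z (subnKC Hjk).
  (* In the last row all phi_{j+s}^R have degree at most k, so their values at z factor out on the
     right and only f_k U_k = V_k remains. *)
  have sk : (size (phiR (j + s)%N) <= k.+1)%N.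
    by rewrite (size_onpR HR) ltnS -(subnKC Hjk) leq_add2l -ltnS.
  by rewrite (wtau_starL HW HL z1 sk) (wsig_onp HW HR z1 sk) mulmxA Hf.
by rewrite -!mulmxA e0 hess eN.
Qed.

End Compression.

(** * Schur iterates of the measure *)

Section MatrixLimits.
Variables (K : numFieldType) (T : Type) (F : set_system T).
Hypothesis FF : Filter F.

Lemma cvg_sumr (I : Type) (r : seq I) (P : pred I) (f : I -> T -> K) (l : I -> K) :
  (forall i, f i @ F --> l i) ->
  (fun t => \sum_(i <- r | P i) f i t) @ F --> \sum_(i <- r | P i) l i.
Proof.
move=> fl; elim: r => [|i r IH].
  by under eq_fun do rewrite big_nil; rewrite big_nil; exact: cvg_cst.
under eq_fun do rewrite big_cons; rewrite big_cons.
by case: (P i) => //; apply: cvgD.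
Qed.

Lemma cvg_prodr (I : Type) (r : seq I) (P : pred I) (f : I -> T -> K) (l : I -> K) :
  (forall i, f i @ F --> l i) ->
  (fun t => \prod_(i <- r | P i) f i t) @ F --> \prod_(i <- r | P i) l i.
Proof.
move=> fl; elim: r => [|i r IH].
  by under eq_fun do rewrite big_nil; rewrite big_nil; exact: cvg_cst.
under eq_fun do rewrite big_cons; rewrite big_cons.
by case: (P i) => //; apply: cvgM.
Qed.

(** Convergence is entrywise, to match the entrywise limit in [schur_step]. *)
Definition mcvg m n (A : T -> 'M[K]_(m, n)) (L : 'M[K]_(m, n)) : Prop :=
  forall i j, (fun t => A t i j) @ F --> L i j.

Lemma mcvgM m n p (A : T -> 'M[K]_(m, n)) (B : T -> 'M[K]_(n, p)) LA LB :
  mcvg A LA -> mcvg B LB -> mcvg (fun t => A t *m B t) (LA *m LB).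
Proof.
move=> cA cB i j; under eq_fun do rewrite mxE; rewrite mxE.
by apply: cvg_sumr => k; apply: cvgM.
Qed.

Lemma cvg_det n (A : T -> 'M[K]_n) L : mcvg A L ->
  (fun t => \det (A t)) @ F --> \det L.
Proof.
move=> cA; rewrite /determinant; apply: cvg_sumr => s.
by apply: cvgM; [exact: cvg_cst|apply: cvg_prodr].
Qed.

(** Cramer's rule; [invmx] is the adjugate over the determinant where the matrix is invertible. *)
Lemma mcvg_inv n (A : T -> 'M[K]_n) L : L \in unitmx ->
  (\forall t \near F, A t \in unitmx) -> mcvg A L ->
  mcvg (fun t => invmx (A t)) (invmx L).
Proof.
move=> uL uA cA i j.
have cd := cvg_det cA.
have dL : \det L != 0 by rewrite -unitfE -unitmxE.
have cvg1 : (fun t => (\det (A t))^-1 * (\adj (A t)) i j) @ F --> (\det L)^-1 * (\adj L) i j.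
  apply: cvgM; first exact: cvgV.
  rewrite !mxE; under eq_fun do rewrite !mxE.
  apply: cvgM; first exact: cvg_cst.
  by apply: cvg_det => x y; rewrite !mxE; under eq_fun do rewrite !mxE; exact: cA.
rewrite {2}/invmx uL mxE; apply: cvg_trans cvg1; apply: near_eq_cvg.
by near=> t; rewrite /invmx (_ : A t \in unitmx) ?mxE //; near: t.
Unshelve. all: by end_near.
Qed.

End MatrixLimits.

Section KernelContinuity.
Variable R : realType.
Local Notation C := (C R).
Local Notation Re := (@complex.Re R).
Local Notation Im := (@complex.Im R).
Variable mu : {measure set R -> \bar R}.

Lemma norm_le_ReIm (z : C) : `|z| <= (`|Re z| + `|Im z|)%:C%C.
Proof.
have nC (x : R) : `|(x%:C)%C| = (`|x|%:C)%C :> C.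
  by rewrite normc_def /= expr0n addr0 sqrtr_sqr.
have ni : `|('i)%C : C| = 1 by rewrite normc_def /= expr0n expr1n add0r sqrtr1.
rewrite {1}[z]complexE; apply: le_trans (ler_normD _ _) _.
by rewrite normrM ni mul1r !nC -rmorphD.
Qed.

(** The factor 2 comes from bounding the real and imaginary parts separately. *)
Lemma cint_norm_le (g : R -> C) (M : R) (s : R -> C) :
  bcont g -> (forall t, `|g t| <= (M%:C)%C) -> cintegrable mu s ->
  `|cint mu (fun t => g t * s t)| <=
    (2 * (M * Rintegral mu setT (fun t => `|Re (s t)| + `|Im (s t)|)))%:C%C.
Proof.
move=> bg gM is_; have [i1 i2] := is_; have [j1 j2] := cintegrableM bg is_.
have iN : mu.-integrable setT (EFin \o (fun t => `|Re (s t)| + `|Im (s t)|)).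
  by apply: integrable_EFinD; exact: integrable_norm.
have iM : mu.-integrable setT (EFin \o (fun t => M * (`|Re (s t)| + `|Im (s t)|))).
  by have := integrableZl measurableT M iN.
have gR t : `|Re (g t)| <= M.
  by have := le_trans (normRe_le (g t)) (gM t); rewrite lecR.
have gI t : `|Im (g t)| <= M.
  by have := le_trans (normIm_le (g t)) (gM t); rewrite lecR.
have part (h : R -> R) : mu.-integrable setT (EFin \o h) ->
    (forall t, `|h t| <= M * (`|Re (s t)| + `|Im (s t)|)) ->
    `|Rintegral mu setT h| <=
      M * Rintegral mu setT (fun t => `|Re (s t)| + `|Im (s t)|).
  move=> ih hM; apply: le_trans (le_normr_Rintegral measurableT ih) _.
  rewrite -RintegralZl //; apply: le_Rintegral => //.
  exact: integrable_norm.
apply: le_trans (norm_le_ReIm _) _; rewrite lecR mulr_natl mulr2n; apply: lerD.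
  apply: part => // t; rewrite ReM mulrDr; apply: le_trans (ler_normB _ _) _.
  by rewrite !normrM; apply: lerD; apply: ler_wpM2r.
apply: part => // t; rewrite ImM mulrDr addrC; apply: le_trans (ler_normD _ _) _.
by rewrite !normrM; apply: lerD; apply: ler_wpM2r.
Qed.

(** Splitting off the first-order term w m(w) of the kernel, with m bounded for |w| < 1/2, bounds
    the change of the integral by a multiple of |w|. *)
Lemma cint_kernel_cvg (k m : C -> R -> C) (s : R -> C) (M : R) :
  (forall w t, `|w| < 1 -> k w t = k 0 t + w * m w t) ->
  (forall w, `|w| < 1 -> bcont (m w)) -> bcont (k 0) ->
  (forall w t, `|w| < 2^-1 -> `|m w t| <= (M%:C)%C) -> cintegrable mu s ->
  (fun w => cint mu (fun t => k w t * s t)) @ (0 : C)^' --> cint mu (fun t => k 0 t * s t).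
Proof.
move=> kE bm b0 mM is_.
pose B : C := (2 * (M * Rintegral mu setT (fun t => `|Re (s t)| + `|Im (s t)|)))%:C%C.
have B0 : 0 <= B.
  apply: le_trans (normr_ge0 (cint mu (fun t => m 0 t * s t))) (cint_norm_le _ _ is_).
    by apply: bm; rewrite normr0.
  by move=> t; apply: mM; rewrite normr0 invr_gt0.
apply/cvgrPdist_le => e e0; near=> w.
have w2 : `|w| < 2^-1 by near: w; apply: dnbhs0_lt; rewrite invr_gt0.
have w1 : `|w| < 1 by apply: lt_trans w2 _; rewrite invf_lt1 ?ltr1n.
(* B may vanish, hence the denominator B + 1. *)
have we : `|w| < e / (B + 1).
  by near: w; apply: dnbhs0_lt; rewrite divr_gt0 // ltr_wpDl.
have ik := cintegrableM b0 is_; have im := cintegrableM (bm w w1) is_.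
have -> : cint mu (fun t => k w t * s t) =
    cint mu (fun t => k 0 t * s t) + w * cint mu (fun t => m w t * s t).
  rewrite -cintZ // -cintD //; last by exact: cintegrableM (bcont_cst w) im.
  by congr cint; apply/funext => t; rewrite kE // mulrDl mulrA.
rewrite opprD addNKr normrN normrM.
have Bw : `|cint mu (fun t => m w t * s t)| <= B.
  by apply: cint_norm_le => //; [exact: bm|move=> t; exact: mM].
apply: le_trans (ler_pM _ _ (ltW we) Bw) _ => //.
rewrite -mulrA ger_pMr // mulrC ler_pdivrMr ?ltr_wpDl // mul1r.
by rewrite lerDl.
Unshelve. all: by end_near.
Qed.

Lemma mcvg_kernel n p (k m : C -> R -> C) (G : R -> 'M[C]_(n, p)) (M : R) :
  (forall w t, `|w| < 1 -> k w t = k 0 t + w * m w t) ->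
  (forall w, `|w| < 1 -> bcont (m w)) -> bcont (k 0) ->
  (forall w t, `|w| < 2^-1 -> `|m w t| <= (M%:C)%C) -> mintegrable mu G ->
  mcvg ((0 : C)^') (fun w => mint mu (fun t => k w t *: G t)) (mint mu (fun t => k 0 t *: G t)).
Proof.
move=> kE bm b0 mM iG a c; have cv := cint_kernel_cvg kE bm b0 mM (iG a c).
have e w : mint mu (fun t => k w t *: G t) a c = cint mu (fun t => k w t * G t a c).
  by rewrite mxE; congr cint; apply/funext => t; rewrite mxE.
have gen (X : C -> 'M[C]_(n, p)) (Y : C -> C) : (forall w, X w a c = Y w) ->
    Y @ (0 : C)^' --> Y 0 -> (fun w => X w a c) @ (0 : C)^' --> X 0 a c.
  by move=> XY; rewrite XY; move: XY => /funext ->.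
exact: gen e cv.
Qed.

End KernelContinuity.

Section SchurStepAlgebra.
Variable F : numClosedFieldType.

(** The Schur step is a linear fractional map. On numerator and denominator, g = V U^-1, it is
    linear: g - a = z rR V1 U^-1 and 1 - a' g = rL U1 U^-1. *)
Lemma schur_step_moebius n (g a a' rR rL U V U1 V1 : 'M[F]_n) (z : F) : z != 0 ->
  rR \in unitmx -> rL \in unitmx -> U \in unitmx -> U1 \in unitmx ->
  g *m U = V -> rL *m U1 = U - a' *m V -> z *: (rR *m V1) = V - a *m U ->
  z^-1 *: (invmx rR *m (g - a) *m invmx (1%:M - a' *m g) *m rL) = V1 *m invmx U1.
Proof.
move=> z0 uR uL uU uU1 gU eU eV.
have e1 : g - a = z *: (rR *m V1 *m invmx U).
  apply: (can_inj (mulmxK uU)); rewrite mulmxBl gU -eV -scalemxAl.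
  by rewrite mulmxKV.
have e2 : 1%:M - a' *m g = rL *m U1 *m invmx U.
  by apply: (can_inj (mulmxK uU)); rewrite mulmxKV // mulmxBl mul1mx -mulmxA gU.
have u3 : rL *m U1 *m invmx U \in unitmx by rewrite !unitmx_mul uL uU1 unitmx_inv.
have e3 : invmx (rL *m U1 *m invmx U) *m rL = U *m invmx U1.
  apply: (can_inj (mulKmx u3)); rewrite mulmxA mulmxV // mul1mx.
  by rewrite -!mulmxA (mulmxA (invmx U)) mulVmx // mul1mx mulmxV // mulmx1.
rewrite e1 e2 -mulmxA e3 -scalemxAr -scalemxAl scalerA mulVf // scale1r.
by rewrite -!mulmxA (mulmxA (invmx rR)) mulVmx // mul1mx (mulmxA (invmx U)) mulVmx // mul1mx.
Qed.

End SchurStepAlgebra.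

Section SchurIterates.
Variables (R : realType) (d : nat).
Local Notation C := (C R).
Local Notation Md := 'M[C]_d.+1.
Variable mu : {measure set R -> \bar R}.
Variables (W : R -> Md) (phiL phiR : nat -> {poly Md}).
Hypothesis HW : is_matrix_measure mu W.
Hypothesis HL : is_ONP_L mu W phiL.
Hypothesis HR : is_ONP_R mu W phiR.
Local Notation alpha := (szego_coef mu W phiL phiR).

Lemma invnorm_cauchy_le (w : C) (t : R) : `|w| < 2^-1 -> `|(expi t - w)^-1| <= 2.
Proof.
move=> w2; have h : 2^-1 <= `|expi t - w|.
  have := lerB_dist (expi t) w; rewrite norm_expi; apply: le_trans.
  by rewrite lerBrDr (le_trans (lerD (lexx _) (ltW w2))) // -mulr2n -[_ *+ 2]mulr_natl divff ?pnatr_eq0.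
rewrite normfV -[leRHS]invrK lef_pV2 // ?posrE ?invr_gt0 //.
by rewrite (lt_le_trans _ h) // invr_gt0.
Qed.

Lemma mcvg_wsig g h :
  mcvg ((0 : C)^') (fun w => wip mu (cauchy w) W g h) (wip mu (cauchy 0) W g h).
Proof.
(* From 1/(t-w) = 1/t + w/(t (t-w)), where |t-w| >= 1/2 for |w| < 1/2. *)
apply: (@mcvg_kernel R mu _ _ _ (fun w t => (expi t)^-1 * (expi t - w)^-1) _ 2).
- move=> w t w1; rewrite /cauchy subr0; have t0 := expi_neq0 t.
  by have tw := expi_subz_neq0 t w1; field; rewrite tw t0.
- move=> w w1; apply: bcontM; last exact: bcont_cauchy.
  by have := bcontV_expiX R 1; under eq_fun do rewrite expr1.
- by apply: bcont_cauchy; rewrite normr0.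
- move=> w t w2; rewrite normrM normfV norm_expi invr1 mul1r.
  by rewrite (_ : (2%:C)%C = 2) ?rmorph_nat //; exact: invnorm_cauchy_le.
- exact: mintegrable_ip.
Qed.

Lemma mcvg_wtau g h :
  mcvg ((0 : C)^') (fun w => wip mu (tcauchy w) W g h) (wip mu (tcauchy 0) W g h).
Proof.
apply: (@mcvg_kernel R mu _ _ _ (fun w t => (expi t - w)^-1) _ 2).
- move=> w t w1; rewrite /tcauchy subr0; have t0 := expi_neq0 t.
  by have tw := expi_subz_neq0 t w1; field; rewrite tw t0.
- by move=> w w1; exact: bcont_cauchy.
- by apply: bcont_tcauchy; rewrite normr0.
- move=> w t w2.
  by rewrite (_ : (2%:C)%C = 2) ?rmorph_nat //; exact: invnorm_cauchy_le.
- exact: mintegrable_ip.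
Qed.

Local Notation U n z := (wip mu (tcauchy z) W (star n (phiL n)) 1).
Local Notation V n z := (wip mu (cauchy z) W (phiR n) 1).
Local Notation f := (schur_fun mu W).

(** At z = 0 the left-hand side of [wsig_onp_step] vanishes. This makes the value of the iterate at
    0 equal to the recursion coefficient. *)
Lemma wsig0_onp n : V n 0 = alpha n *m U n 0.
Proof.
have := wsig_onp_step HW HL HR (z := 0) _ n; rewrite normr0 ltr01 scale0r.
by move=> /(_ isT)/esym/eqP; rewrite subr_eq0 => /eqP.
Qed.

(* At 0 the Schur step is defined by a limit, whence the continuity of both Cauchy transforms. *)
Lemma schur_step_szego n (g : C -> Md) :
  (forall z, `|z| < 1 -> g z *m U n z = V n z) ->
  g 0 = alpha n /\
  (forall z, `|z| < 1 -> schur_step g z *m U n.+1 z = V n.+1 z).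
Proof.
move=> gU; have uU m z : `|z| < 1 -> U m z \in unitmx.
  by move=> z1; have [] := wtau_starL_unit HW HL z1 m.
have z01 : `|0 : C| < 1 by rewrite normr0.
have g0 : g 0 = alpha n.
  by apply: (can_inj (mulmxK (uU n 0 z01))); rewrite gU // wsig0_onp.
split; first exact: g0.
move=> z z1.
have step w : `|w| < 1 -> w != 0 ->
    w^-1 *: (invmx (rhoR (g 0)) *m (g w - g 0) *m invmx (1%:M - adj (g 0) *m g w) *m rhoL (g 0)) =
    V n.+1 w *m invmx (U n.+1 w).
  move=> w1 w0; rewrite g0; apply: (@schur_step_moebius _ _ _ _ _ _ _ (U n w) (V n w)).
  - exact: w0.
  - by apply: posdef_unitmx; exact: posdef_rhoR.
  - by apply: posdef_unitmx; exact: posdef_rhoL.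
  - exact: uU w1.
  - exact: uU w1.
  - exact: gU.
  - by rewrite [in RHS](wtau_starL_prev HW HL HR w1) addrK.
  - exact: wsig_onp_step.
rewrite /schur_step; case: eqP => [z0|/eqP z0]; last by rewrite (step z z1 z0) (mulmxKV (uU _ _ z1)).
rewrite z0; suff -> : (\matrix_(a, c) lim ((fun w =>
    (w^-1 *: (invmx (rhoR (g 0)) *m (g w - g 0) *m invmx (1%:M - adj (g 0) *m g w) *m rhoL (g 0))) a c)
     @ (0 : C)^')) = V n.+1 0 *m invmx (U n.+1 0) by rewrite (mulmxKV (uU _ _ z01)).
apply/matrixP => a c; rewrite mxE.
have nearU : \forall w \near (0 : C)^', U n.+1 w \in unitmx.
  by near=> w; apply: uU; near: w; exact: dnbhs0_lt.
have FF : Filter ((0 : C)^') by exact: dnbhs_filter.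
have cv := mcvgM FF (@mcvg_wsig (phiR n.+1) 1)
  (mcvg_inv FF (uU n.+1 0 z01) nearU (@mcvg_wtau (star n.+1 (phiL n.+1)) 1)).
apply: norm_cvg_lim; apply: cvg_trans (cv a c); apply: near_eq_cvg; near=> w.
rewrite -step //; first by near: w; exact: dnbhs0_lt.
by near: w; exact: nbhs_dnbhs_neq.
Unshelve. all: by end_near.
Qed.

Lemma wip_1_1 (k : R -> C) : wip mu k W 1 1 = mint mu (fun t => k t *: W t).
Proof. by apply: eq_mint => t; rewrite (evC 1) adj1 mul1mx mulmx1. Qed.

Lemma star0_1 : star 0 (1 : {poly Md}) = 1.
Proof.
apply/polyP => -[|i]; rewrite coef_star !coef1 //=; exact: adj1.
Qed.

(** Geronimus' relation. The induction starts from phi_0 = 1, where it is [schur_funE]. *)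
Lemma schur_iter_szego n :
  (forall z, `|z| < 1 -> schur_iter f n z *m U n z = V n z).
Proof.
elim: n => [|n IH] z z1; last by have [_] := schur_step_szego IH; apply.
have [L0 _] := HL; have [R0 _] := HR.
rewrite /schur_iter /= L0 R0 star0_1 !wip_1_1 schur_funE // mulmxKV //.
by case: HW => pV [iV V1]; exact: cauchy_integral_unit.
Qed.

Lemma schur_iter_alpha n : schur_iter f n 0 = alpha n.
Proof. by have [] := schur_step_szego (schur_iter_szego n). Qed.

End SchurIterates.

(** * Left-right duality *)

Section MoebiusInvariance.
Variable F : numClosedFieldType.

(* The pairs (A, B) and (X, D) are moved by mutually inverse J-unitary matrices. *)
Lemma moebius_pairing n (a a' r l A B X D A1 B1 X1 D1 : 'M[F]_n) :
  l \in unitmx -> r \in unitmx ->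
  l *m l = 1%:M - a' *m a -> r *m r = 1%:M - a *m a' ->
  r *m a = a *m l -> a' *m r = l *m a' ->
  A1 *m l = A - B *m a -> B1 *m r = B - A *m a' ->
  l *m X1 = X - a' *m D -> r *m D1 = D - a *m X ->
  A *m X = B *m D -> A1 *m X1 = B1 *m D1.
Proof.
move=> ul ur ll rr ra ar eA eB eX eD e.
have al : a *m invmx l = invmx r *m a.
  by apply: (can_inj (mulmxK ul)); rewrite mulmxKV // -mulmxA -ra mulKmx.
have ar' : a' *m invmx r = invmx l *m a'.
  by apply: (can_inj (mulmxK ur)); rewrite mulmxKV // -mulmxA ar mulKmx.
have {}eA : A1 = (A - B *m a) *m invmx l by rewrite -eA mulmxK.
have {}eB : B1 = (B - A *m a') *m invmx r by rewrite -eB mulmxK.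
have eX' : X1 = invmx l *m (X - a' *m D) by rewrite -eX mulKmx.
have eD' : D1 = invmx r *m (D - a *m X) by rewrite -eD mulKmx.
(* [h1] and [h2] recover (X, D) from (X1, D1); collecting the coefficients of A and B then gives A1
   X1 - B1 D1 = A X - B D. *)
have h1 : invmx l *m X1 + a' *m (invmx r *m D1) = X.
  have h0 : (X - a' *m D) + a' *m (D - a *m X) = l *m (l *m X).
    by rewrite mulmxBr addrA subrK [in RHS]mulmxA ll mulmxBl mul1mx !mulmxA.
  rewrite mulmxA ar' -(mulmxA (invmx l)) -mulmxDr eX' eD' (mulmxA a') ar'.
  by rewrite -(mulmxA (invmx l) a') -mulmxDr h0 !mulKmx.
have h2 : a *m (invmx l *m X1) + invmx r *m D1 = D.
  have h0 : a *m (X - a' *m D) + (D - a *m X) = r *m (r *m D).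
    by rewrite mulmxBr addrC addrA subrK [in RHS]mulmxA rr mulmxBl mul1mx !mulmxA.
  rewrite mulmxA al -(mulmxA (invmx r)) -mulmxDr eX' eD' (mulmxA a) al.
  by rewrite -(mulmxA (invmx r) a) -mulmxDr h0 !mulKmx.
apply/eqP; rewrite -subr_eq0; apply/eqP.
have -> : A1 *m X1 = A *m (invmx l *m X1) - B *m (a *m (invmx l *m X1)).
  by rewrite eA -mulmxA mulmxBl !mulmxA.
have -> : B1 *m D1 = B *m (invmx r *m D1) - A *m (a' *m (invmx r *m D1)).
  by rewrite eB -mulmxA mulmxBl !mulmxA.
rewrite opprB addrACA -mulmxDr h1 -opprD -mulmxDr h2 e.
by rewrite subrr.
Qed.

Lemma trmx_1subM n (A B : 'M[F]_n) : (1%:M - A *m B)^T = 1%:M - B^T *m A^T.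
Proof. by rewrite linearB /= trmx1 trmx_mul. Qed.

Lemma trmx_linrel n (l X Y S a lt Xt Yt St a_t : 'M[F]_n) (z : F) :
  Xt = X^T -> lt = l^T -> Yt = Y^T -> St = S^T -> a_t = a^T ->
  Xt *m lt = z *: Yt - St *m a_t -> l *m X = z *: Y - a *m S.
Proof. move=> -> -> -> -> -> e; by apply: trmx_inj; rewrite linearB linearZ /= !trmx_mul. Qed.

Lemma trmx_linrel' n (l X Y S a lt Xt Yt St a_t : 'M[F]_n) (z : F) :
  Xt = X^T -> lt = l^T -> Yt = Y^T -> St = S^T -> a_t = a^T ->
  Xt *m lt = St - z *: Yt *m a_t -> l *m X = S - a *m (z *: Y).
Proof.
move=> -> -> -> -> -> e; by apply: trmx_inj; rewrite linearB /= !trmx_mul linearZ.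
Qed.

Lemma trmx_lincomb n (l a lt a_t X Y S : 'M[F]_n) : lt = l^T -> a_t = a^T ->
  S = lt *m X + a_t *m Y -> S^T = X^T *m l + Y^T *m a.
Proof. by move=> -> -> ->; rewrite linearD /= !trmx_mul !trmxK. Qed.

Lemma trmx_lincombZ n (l a lt a_t X Y S : 'M[F]_n) (z : F) : lt = l^T -> a_t = a^T ->
  z *: (lt *m X) = Y - a_t *m S -> z *: X^T *m l = Y^T - S^T *m a.
Proof.
move=> -> -> /(congr1 trmx).
by rewrite linearZ linearB /= !trmx_mul !trmxK scalemxAl.
Qed.

Lemma comm_affine n (Y T U V Ut Vt : 'M[F]_n) (z : F) : Vt = Y^T -> Ut = T^T ->
  U = T -> V = Y -> T = 1%:M + z *: Y -> Vt^T *m U = Ut^T *m V.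
Proof.
move=> -> -> -> -> ->; rewrite !trmxK.
by rewrite mulmxDl mulmxDr mul1mx mulmx1 -scalemxAl -scalemxAr.
Qed.

Lemma comm_ratio n (a U V Ut Vt : 'M[F]_n) : V = a *m U -> Vt = a^T *m Ut ->
  Vt^T *m U = Ut^T *m V.
Proof. by move=> -> ->; rewrite trmx_mul trmxK mulmxA. Qed.

Lemma scale_cancel n (A B D E : 'M[F]_n) (z : F) : z != 0 ->
  (z *: A) *m B = D *m (z *: E) -> A *m B = D *m E.
Proof. by move=> z0; rewrite -scalemxAl -scalemxAr; exact: scalerI. Qed.

Lemma scale_move n (A B D E : 'M[F]_n) (z : F) :
  A *m B = D *m E -> A *m (z *: B) = (z *: D) *m E.
Proof. by move=> e; rewrite -scalemxAr -scalemxAl e. Qed.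

Lemma trmx_ratio n (U V Ut Vt g : 'M[F]_n) : U \in unitmx ->
  Vt^T *m U = Ut^T *m V -> g *m U = V -> g^T *m Ut = Vt.
Proof.
move=> uU e gU; apply: trmx_inj; rewrite trmx_mul trmxK; apply: (can_inj (mulmxK uU)).
by rewrite -mulmxA gU e.
Qed.

End MoebiusInvariance.

Lemma subr_of_addr (V : zmodType) (x y w : V) : x = y + w -> y = x - w.
Proof. by move=> ->; rewrite addrK. Qed.

Lemma adj_intertwine (R : realType) n (r l a : 'M[C R]_n) :
  adj r = r -> adj l = l -> r *m a = a *m l -> adj a *m r = l *m adj a.
Proof. by move=> hr hl e; rewrite -{1}hr -adjM e adjM hl. Qed.

Section Commutation.
Variables (R : realType) (d : nat).
Local Notation C := (C R).
Local Notation Md := 'M[C]_d.+1.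
Variable mu : {measure set R -> \bar R}.
Variables (W : R -> Md) (phiL phiR : nat -> {poly Md}).
Hypothesis HW : is_matrix_measure mu W.
Hypothesis HL : is_ONP_L mu W phiL.
Hypothesis HR : is_ONP_R mu W phiR.
Local Notation alpha := (szego_coef mu W phiL phiR).

Let Wt t := (W t)^T.
Let psiL i := trp (phiR i).
Let psiR i := trp (phiL i).
Let HWt : is_matrix_measure mu Wt := is_matrix_measure_tr HW.
Let HLt : is_ONP_L mu Wt psiL := is_ONP_L_tr HR.
Let HRt : is_ONP_R mu Wt psiR := is_ONP_R_tr HL.

Lemma szego_coef_trE n : szego_coef mu Wt psiL psiR n = (alpha n)^T.
Proof. by apply: szego_coef_tr. Qed.

Lemma rhoL_tr n : rhoL (alpha n)^T = (rhoR (alpha n))^T.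
Proof.
apply: sqrtm_posdef; first exact: (posdef_tr (posdef_rhoR HW HL HR n)).
apply: etrans (esym (trmx_mul _ _)) _.
apply: etrans (congr1 trmx (sqr_rhoR HW HL HR n)) _.
by apply: etrans (trmx_1subM _ _) _; rewrite adj_tr.
Qed.

Lemma rho_unit n : (rhoL (alpha n) \in unitmx) * (rhoR (alpha n) \in unitmx).
Proof.
by split; apply: posdef_unitmx; [exact: posdef_rhoL|exact: posdef_rhoR].
Qed.

Lemma adj_rho_comm n : adj (alpha n) *m rhoR (alpha n) = rhoL (alpha n) *m adj (alpha n).
Proof.
exact: adj_intertwine (rhoR_herm HW HL HR n) (rhoL_herm HW HL HR n) (rho_comm HW HL HR n).
Qed.

Section Evaluations.
Variable z : C.

Lemma ev_lincomb (p q : {poly Md}) (x y : Md) :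
  ev (p * x%:P + q * y%:P) z = ev p z *m x + ev q z *m y.
Proof. by rewrite evD 2!evM 2!evC. Qed.

Lemma ev_szegoR n : ev (phiR n.+1) z *m rhoR (alpha n) =
  z *: ev (phiR n) z - ev (star n (phiL n)) z *m adj (alpha n).
Proof.
apply: subr_of_addr; apply: etrans (esym (evXM _ _)) _.
exact: etrans (congr1 (fun p => ev p z) (szegoR HW HL HR n)) (ev_lincomb _ _ _ _).
Qed.

Lemma ev_starL n : ev (star n.+1 (phiL n.+1)) z *m rhoL (alpha n) =
  ev (star n (phiL n)) z - z *: ev (phiR n) z *m alpha n.
Proof.
apply: subr_of_addr.
apply: etrans (congr1 (fun p => ev p z) (szego_starL HW HL HR n)) _.
apply: etrans (ev_lincomb _ _ _ _) _.
exact: eq_lincomb erefl (evXM _ _) erefl erefl.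
Qed.

End Evaluations.

Lemma ev_onp_comm0 z :
  ev (star 0 (phiL 0)) z *m ev (phiL 0) z = ev (phiR 0) z *m ev (star 0 (phiR 0)) z.
Proof. by have [-> _] := HL; have [-> _] := HR; rewrite star0_1. Qed.

End Commutation.

Section Duality.
Variables (R : realType) (d : nat).
Local Notation C := (C R).
Local Notation Md := 'M[C]_d.+1.
Variable mu : {measure set R -> \bar R}.
Variables (W : R -> Md) (phiL phiR : nat -> {poly Md}).
Hypothesis HW : is_matrix_measure mu W.
Hypothesis HL : is_ONP_L mu W phiL.
Hypothesis HR : is_ONP_R mu W phiR.
Local Notation alpha := (szego_coef mu W phiL phiR).

Let Wt t := (W t)^T.
Let psiL i := trp (phiR i).
Let psiR i := trp (phiL i).
Let HWt : is_matrix_measure mu Wt := is_matrix_measure_tr HW.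
Let HLt : is_ONP_L mu Wt psiL := is_ONP_L_tr HR.
Let HRt : is_ONP_R mu Wt psiR := is_ONP_R_tr HL.
Let at_tr n : szego_coef mu Wt psiL psiR n = (alpha n)^T := szego_coef_trE HL HR n.
Let rR_tr n : rhoR (szego_coef mu Wt psiL psiR n) = (rhoL (alpha n))^T.
Proof. by rewrite at_tr; exact: rhoR_tr. Qed.
Let rL_tr n : rhoL (szego_coef mu Wt psiL psiR n) = (rhoR (alpha n))^T.
Proof. by rewrite at_tr; exact: rhoL_tr. Qed.
Let aa_tr n : adj (szego_coef mu Wt psiL psiR n) = (adj (alpha n))^T.
Proof. by rewrite at_tr; exact: adj_tr. Qed.
Let ev_starR n z : ev (star n (psiL n)) z = (ev (star n (phiR n)) z)^T.
Proof. by rewrite /psiL star_trp ev_trp. Qed.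
Let ev_phiL n z : ev (psiR n) z = (ev (phiL n) z)^T.
Proof. exact: ev_trp. Qed.

Lemma ev_szegoL z n : rhoL (alpha n) *m ev (phiL n.+1) z =
  z *: ev (phiL n) z - adj (alpha n) *m ev (star n (phiR n)) z.
Proof.
exact: trmx_linrel (ev_phiL n.+1 z) (rR_tr n) (ev_phiL n z) (ev_starR n z) (aa_tr n)
  (ev_szegoR HWt HLt HRt z n).
Qed.

Lemma ev_starR_next z n : rhoR (alpha n) *m ev (star n.+1 (phiR n.+1)) z =
  ev (star n (phiR n)) z - alpha n *m (z *: ev (phiL n) z).
Proof.
exact: trmx_linrel' (ev_starR n.+1 z) (rL_tr n) (ev_phiL n z) (ev_starR n z) (at_tr n)
  (ev_starL HWt HLt HRt z n).
Qed.

(** The recursion preserves the pairing of [moebius_pairing]. Thus b_j, the quotient phi_j^L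
    (phi_j^{R,*})^-1, is also (phi_j^{L,*})^-1 phi_j^R, the form needed for the transposed
    measure. *)
Lemma ev_onp_comm z n :
  ev (star n (phiL n)) z *m ev (phiL n) z = ev (phiR n) z *m ev (star n (phiR n)) z.
Proof.
elim: n => [|n IH]; first exact: (ev_onp_comm0 HL HR z).
have [ul ur] := rho_unit HW HL HR n.
apply: (moebius_pairing ul ur (sqr_rhoL HW HL HR n) (sqr_rhoR HW HL HR n)
  (rho_comm HW HL HR n) (adj_rho_comm HW HL HR n) (ev_starL HW HL HR z n)
  (ev_szegoR HW HL HR z n) (ev_szegoL z n) (ev_starR_next z n)).
exact: scale_move.
Qed.

Section Disc.
Variable z : C.
Hypothesis z1 : `|z| < 1.
Local Notation U n := (wip mu (tcauchy z) W (star n (phiL n)) 1).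
Local Notation V n := (wip mu (cauchy z) W (phiR n) 1).
Local Notation Ut n := (wip mu (tcauchy z) Wt (star n (psiL n)) 1).
Local Notation Vt n := (wip mu (cauchy z) Wt (psiR n) 1).

Lemma UtT_step n : (Ut n.+1)^T *m rhoR (alpha n) =
  (Ut n)^T - (Vt n)^T *m adj (alpha n).
Proof.
apply: subr_of_addr.
exact: trmx_lincomb (rL_tr n) (aa_tr n) (wtau_starL_prev HWt HLt HRt z1 n 1).
Qed.

Lemma VtT_step n : z *: (Vt n.+1)^T *m rhoL (alpha n) =
  (Vt n)^T - (Ut n)^T *m alpha n.
Proof.
exact: trmx_lincombZ (rR_tr n) (at_tr n) (wsig_onp_step HWt HLt HRt z1 n).
Qed.

Lemma cauchy_comm0 : (Vt 0)^T *m U 0 = (Ut 0)^T *m V 0.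
Proof.
have [L0 _] := HL; have [R0 _] := HR.
have E (k : R -> C) : wip mu k Wt 1 1 = (mint mu (fun t => k t *: W t))^T.
  rewrite wip_1_1 -mint_tr; apply: eq_mint => t; exact: (esym (linearZ _ _)).
have p0 : psiR 0 = 1 by rewrite /psiR L0 trp1.
have s0 : star 0 (psiL 0) = 1 by rewrite /psiL R0 trp1 star0_1.
have s0' : star 0 (phiL 0) = 1 by rewrite L0 star0_1.
have eV : Vt 0 = _ := etrans (congr1 (fun p => wip mu (cauchy z) Wt p 1) p0) (E _).
have eU : Ut 0 = _ := etrans (congr1 (fun p => wip mu (tcauchy z) Wt p 1) s0) (E _).
have eU' : U 0 = _ := etrans (congr1 (fun p => wip mu (tcauchy z) W p 1) s0') (wip_1_1 mu W _).
have eV' : V 0 = _ := etrans (congr1 (fun p => wip mu (cauchy z) W p 1) R0) (wip_1_1 mu W _).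
case: HW => _ [iW W1]; have := tcauchy_integral iW z1; rewrite W1.
exact: comm_affine eV eU eU' eV'.
Qed.

(** The same invariance for the Cauchy transforms. Each step produces a factor z to be cancelled, so
    z = 0 is treated apart: there both quotients are recursion coefficients. *)
Lemma cauchy_comm n : (Vt n)^T *m U n = (Ut n)^T *m V n.
Proof.
have [z0|z0] := eqVneq z 0.
  have e1 : V n = alpha n *m U n by rewrite z0; exact: wsig0_onp.
  have e2 : Vt n = (alpha n)^T *m Ut n.
    by rewrite -at_tr z0; exact: wsig0_onp.
  exact: comm_ratio e1 e2.
elim: n => [|n IH]; first exact: cauchy_comm0.
have [ul ur] := rho_unit HW HL HR n.
have eU : rhoL (alpha n) *m U n.+1 = U n - adj (alpha n) *m V n.
  by apply: subr_of_addr; exact: wtau_starL_prev.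
have eV : rhoR (alpha n) *m (z *: V n.+1) = V n - alpha n *m U n.
  by rewrite -scalemxAr; exact: wsig_onp_step.
exact: scale_cancel z0 (moebius_pairing ul ur (sqr_rhoL HW HL HR n) (sqr_rhoR HW HL HR n)
  (rho_comm HW HL HR n) (adj_rho_comm HW HL HR n) (VtT_step n) (UtT_step n) eU eV IH).
Qed.

(** Transposing the measure thus transposes the values of the Schur iterates. *)
Lemma schur_value_dual n (g : Md) : g *m U n = V n -> g^T *m Ut n = Vt n.
Proof.
have [uU _] := wtau_starL_unit HW HL z1 n.
exact: trmx_ratio uU (cauchy_comm n).
Qed.

End Disc.
End Duality.

(** * Inverse iterates *)

Section InverseSchurStep.
Variable F : numClosedFieldType.

(* A singular 1 + a g is excluded by the invertibility of P: [invmx] fixes singular matrices. *)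
Lemma inverse_schur_step n (a a' l r g S P S1 P1 : 'M[F]_n) (z : F) :
  z != 0 -> l \in unitmx -> r \in unitmx ->
  l *m l = 1%:M - a' *m a -> r *m r = 1%:M - a *m a' ->
  r *m a = a *m l -> a' *m r = l *m a' ->
  l *m P1 = z *: P - a' *m S -> r *m S1 = S - a *m (z *: P) -> P \in unitmx ->
  z^-1 *: (invmx l *m (g + a') *m invmx (1%:M + a *m g) *m r) *m S = P ->
  g *m S1 = P1.
Proof.
move=> z0 ul ur ll rr ra ar eP eS uP e.
have uT : 1%:M + a *m g \in unitmx.
  move: uP; rewrite -e unitmx_mul => /andP[+ _].
  rewrite unitmxZ ?unitfE ?invr_eq0 // !unitmx_mul !unitmx_inv.
  by case/andP=> /andP[_ ->].
pose Y := invmx (1%:M + a *m g) *m (r *m S).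
have eY : Y + a *m (g *m Y) = r *m S.
  by rewrite -{1}[Y]mul1mx mulmxA -mulmxDl /Y mulKVmx.
have egY : g *m Y = z *: (l *m P) - a' *m Y.
  apply: subr_of_addr; rewrite -mulmxDl -e -!scalemxAl -scalemxAr scalerA mulfV // scale1r.
  by rewrite /Y -!mulmxA mulKVmx.
(* Eliminating g Y between [eY] and [egY] gives (1 - a a') Y = r (S - a z P), that is r^2 Y = r^2
   S1. *)
have YS1 : Y = S1.
  have h : a *m (g *m Y) = r *m (a *m (z *: P)) - a *m (a' *m Y).
    by rewrite egY mulmxBr; congr (_ - _); rewrite [RHS]mulmxA ra -mulmxA -[l *m (z *: P)]scalemxAr.
  apply: (can_inj (mulKmx ur)); apply: (can_inj (mulKmx ur)).
  rewrite [in RHS]eS mulmxBr -eY h addrA addrAC addrK.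
  by rewrite mulmxA rr mulmxBl mul1mx mulmxA.
rewrite -YS1 egY YS1; apply: (can_inj (mulKmx ul)).
rewrite mulmxBr eP (mulmxA l a') -ar -(mulmxA a' r) eS mulmxBr opprB addrA.
congr (_ - _); rewrite -scalemxAr mulmxA ll mulmxBl mul1mx scalerBr.
by rewrite -mulmxA !scalemxAr subrK.
Qed.

(** The points where p(z) is singular are thus the zeros of a scalar polynomial. *)
Lemma horner_det d (p : {poly 'M[F]_d.+1}) :
  exists q : {poly F}, forall z, q.[z] = \det p.[z%:M].
Proof.
pose pm := \matrix_(i, j) \poly_(k < size p) (p`_k i j).
exists (\det pm) => z; rewrite -[LHS]/(horner_eval z _) -det_map_mx; congr (\det _).
apply/matrixP => i j; rewrite [LHS]mxE [pm i j]mxE /= /horner_eval horner_poly.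
rewrite (horner_coef p) summxE; apply: eq_bigr => k _.
have -> : (z%:M : 'M[F]_d.+1) ^+ k = (z ^+ k)%:M by rewrite rmorphXn.
have -> : p`_k * (z ^+ k)%:M = z ^+ k *: p`_k := mul_mx_scalar _ _.
by rewrite mxE mulrC.
Qed.

Lemma horner_entry d (p : {poly 'M[F]_d.+1}) i j :
  exists q : {poly F}, forall z, q.[z] = p.[z%:M] i j.
Proof.
exists (\poly_(k < size p) (p`_k i j)) => z; rewrite horner_poly.
rewrite (horner_coef p) summxE; apply: eq_bigr => k _.
have -> : (z%:M : 'M[F]_d.+1) ^+ k = (z ^+ k)%:M by rewrite rmorphXn.
have -> : p`_k * (z ^+ k)%:M = z ^+ k *: p`_k := mul_mx_scalar _ _.
by rewrite mxE mulrC.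
Qed.

End InverseSchurStep.

Section PolynomialZeros.
Variable K : numFieldType.

Lemma cvg_horner (p : {poly K}) (z : K) : p.[w] @[w --> z] --> p.[z].
Proof.
have FF : Filter (nbhs z) by exact: nbhs_filter.
elim/poly_ind: p => [|p c IH].
  by rewrite horner0 (_ : horner 0 = cst 0); [exact: (@cvg_cst _ _ _ (nbhs z))|apply/funext => w; rewrite horner0].
rewrite hornerMXaddC (_ : horner _ = fun w => p.[w] * w + c); last first.
  by apply/funext => w; rewrite hornerMXaddC.
by apply: cvgD; [apply: cvgM|exact: (@cvg_cst _ _ _ (nbhs z))].
Qed.

Lemma near_horner_neq0 (p : {poly K}) (z : K) : p != 0 ->
  \forall w \near z^', p.[w] != 0.
Proof.
move=> p0; have [m [q]] := multiplicity_XsubC p z; rewrite p0 /= => qz ->.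
have qn : \forall w \near z, q.[w] != 0.
  exact: cvgr_neq0 (@cvg_horner q z) qz.
near=> w; rewrite hornerM mulf_neq0 //; first by near: w; exact: nbhs_dnbhs.
rewrite horner_exp expf_neq0 // hornerXsubC subr_eq0.
by near: w; exact: nbhs_dnbhs_neq.
Unshelve. all: by end_near.
Qed.

End PolynomialZeros.

Section InverseIterates.
Variables (R : realType) (d : nat).
Local Notation C := (C R).
Local Notation Md := 'M[C]_d.+1.
Variable mu : {measure set R -> \bar R}.
Variables (W : R -> Md) (phiL phiR : nat -> {poly Md}).
Hypothesis HW : is_matrix_measure mu W.
Hypothesis HL : is_ONP_L mu W phiL.
Hypothesis HR : is_ONP_R mu W phiR.
Local Notation alpha := (szego_coef mu W phiL phiR).

Lemma det_onpL_poly l : exists2 q : {poly C}, q != 0 &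
  forall z, q.[z] != 0 -> ev (phiL l) z \in unitmx.
Proof.
have [q qE] := horner_det (phiL l).
exists q; last by move=> z; rewrite qE unitmxE unitfE.
(* Reversal relates the points 1/2 and 2: phi_l^{L,*} is invertible at 1/2, inside the disc, hence
   phi_l^L is invertible at 2 and its determinant is not the zero polynomial. *)
have w1 : `|2^-1 : C| < 1 by rewrite normfV normr_nat invf_lt1 ?ltr1n.
have w0 : (2^-1 : C) != 0 by rewrite invr_eq0 pnatr_eq0.
have [_] := wtau_starL_unit HW HL w1 l.
rewrite (ev_star (eq_leq (size_onpL HL l)) w0) unitmxZ; last by rewrite unitfE expf_neq0.
rewrite adj_unitmx unitmxE unitfE -qE; apply: contraNneq => ->.
by rewrite horner0.
Qed.

Lemma rhoL_Nadj (a : Md) : rhoL (- adj a) = rhoR a.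
Proof. by rewrite /rhoL /rhoR adjN adjK mulNmx mulmxN opprK. Qed.

Lemma rhoR_Nadj (a : Md) : rhoR (- adj a) = rhoL a.
Proof. by rewrite /rhoL /rhoR adjN adjK mulNmx mulmxN opprK. Qed.

Variables (i : nat) (b : C -> Md).
Hypothesis b0 : forall m, (m < i)%N -> schur_iter b m 0 = - adj (alpha (i - m.+1)%N).
Hypothesis b1 : forall z, `|z| < 1 -> schur_iter b i z = 1%:M.

(** Levels are counted from the terminal iterate: iterate i - l of b_i plays the role of b_l.
    Inverting the Schur step with parameter -alpha_l^dag leads from b_l to b_{l+1}. *)
Lemma inverse_iterate_step l (z : C) : (l < i)%N -> `|z| < 1 -> z != 0 ->
  ev (phiL l) z \in unitmx ->
  schur_iter b (i - l) z *m ev (star l (phiR l)) z = ev (phiL l) z ->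
  schur_iter b (i - l.+1) z *m ev (star l.+1 (phiR l.+1)) z = ev (phiL l.+1) z.
Proof.
move=> li z1 z0 uP.
have -> : (i - l = (i - l.+1).+1)%N by rewrite subnSK.
have e0 : schur_iter b (i - l.+1) 0 = - adj (alpha l).
  have mi : (i - l.+1 < i)%N by rewrite subnSK ?leq_subr.
  have idx : (i - (i - l.+1).+1 = l)%N by rewrite subnSK // subKn // ltnW.
  have e := b0 mi; rewrite idx in e; exact e.
have [ul ur] := rho_unit HW HL HR l.
rewrite /schur_iter iterS -/(schur_iter b (i - l.+1)) /schur_step (negPf z0) e0.
rewrite rhoR_Nadj rhoL_Nadj opprK adjN adjK mulNmx opprK.
exact: inverse_schur_step z0 ul ur (sqr_rhoL HW HL HR l) (sqr_rhoR HW HL HR l)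
  (rho_comm HW HL HR l) (adj_rho_comm HW HL HR l) (ev_szegoL HW HL HR z l)
  (ev_starR_next HW HL HR z l) uP.
Qed.

Lemma inverse_iterate_generic (z : C) : `|z| < 1 -> z != 0 ->
  (forall l, (l < i)%N -> ev (phiL l) z \in unitmx) ->
  b z *m ev (star i (phiR i)) z = ev (phiL i) z.
Proof.
move=> z1 z0 uP.
have [L0 _] := HL; have [R0 _] := HR.
suff H l : (l <= i)%N -> schur_iter b (i - l) z *m ev (star l (phiR l)) z = ev (phiL l) z.
  by have := H i (leqnn i); rewrite subnn.
elim: l => [_|l IH li].
  by rewrite subn0 (b1 z1) L0 R0 star0_1 mul1mx.
exact: inverse_iterate_step li z1 z0 (uP l li) (IH (ltnW li)).
Qed.

Hypothesis bD : forall z : C, `|z| < 1 -> forall a c, derivable (fun w : C => b w a c) z 1.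

Lemma inverse_iterate (z : C) : `|z| < 1 -> b z *m ev (star i (phiR i)) z = ev (phiL i) z.
Proof.
move=> z1.
(* Q is the product of X and of the determinants of phi_l^L for l < i; its zeros contain all points
   where the inversion may break down. *)
have [Q Q0 QP] : exists2 q : {poly C}, q != 0 &
    forall w, q.[w] != 0 -> w != 0 /\ forall l, (l < i)%N -> ev (phiL l) w \in unitmx.
  elim: (i) => [|n [q q0 qP]].
    by exists 'X; [rewrite polyX_eq0|move=> w; rewrite hornerX].
  have [r r0 rP] := det_onpL_poly n; exists (q * r); first by rewrite mulf_neq0.
  move=> w; rewrite hornerM mulf_eq0 negb_or => /andP[/qP[w0 uq] /rP ur].
  split; first exact: w0.
  by move=> l; rewrite ltnS leq_eqVlt => /predU1P[->|]; [exact: ur|exact: uq].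
have near1 : \forall w \near z, `|w| < 1.
  apply/nbhs_ballP; exists (1 - `|z|); first by rewrite /= subr_gt0.
  move=> w /= zw; have h : `|w| <= `|z| + `|z - w|.
    by rewrite -{1}[w](subKr z); exact: ler_normB.
  by apply: (le_lt_trans h); rewrite -ltrBrDl.
have nearE : \forall w \near z^', b w *m ev (star i (phiR i)) w = ev (phiL i) w.
  near=> w.
  have [w0 uw] : w != 0 /\ forall l, (l < i)%N -> ev (phiL l) w \in unitmx.
    by apply: QP; near: w; exact: near_horner_neq0.
  by apply: inverse_iterate_generic => //; near: w; exact: nbhs_dnbhs.
have FF : Filter (z^') by exact: dnbhs_filter.
have c1 : mcvg (z^') b (b z).
  move=> a c; apply: cvg_trans (cvg_app _ (@nbhs_dnbhs _ z)) _.
  by apply: differentiable_continuous; apply/derivable1_diffP; exact: bD.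
have cev (p : {poly Md}) : mcvg (z^') (ev p) (ev p z).
  move=> a c; have [q qE] := horner_entry p a c.
  rewrite -[ev p z a c]qE; under eq_fun do rewrite -[ev p _ a c]qE.
  apply: cvg_trans (cvg_app _ (@nbhs_dnbhs _ z)) _; exact: cvg_horner.
apply/matrixP => a c.
have cl : (fun w => (b w *m ev (star i (phiR i)) w) a c) @ z^' -->
    (b z *m ev (star i (phiR i)) z) a c.
  exact: (mcvgM FF c1 (@cev (star i (phiR i)))).
have cr : (fun w => ev (phiL i) w a c) @ z^' --> ev (phiL i) z a c by exact: cev.
suff cr' : (fun w => (b w *m ev (star i (phiR i)) w) a c) @ z^' --> ev (phiL i) z a c.
  by apply: (cvg_unique _ cl cr'); exact: norm_hausdorff.
apply: cvg_trans cr; apply: near_eq_cvg; near=> w.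
have e : b w *m ev (star i (phiR i)) w = ev (phiL i) w by near: w.
by rewrite e.
Unshelve. all: by end_near.
Qed.

End InverseIterates.

(** * Transposition *)

Section Assembly.
Variable F : numClosedFieldType.

Lemma foldr_mulmx n (T : nat -> 'M[F]_n) (B : 'M[F]_n) s :
  foldr (fun i A => T i *m A) B s = foldr (fun i A => T i *m A) 1%:M s *m B.
Proof. by elim: s => [|x s IH] /=; rewrite ?mul1mx // IH mulmxA. Qed.

Lemma trmx_foldr_mulmx n (T T' : nat -> 'M[F]_n) s : (forall i, (T i)^T = T' i) ->
  (foldr (fun i A => T i *m A) 1%:M s)^T = foldr (fun i A => T' i *m A) 1%:M (rev s).
Proof.
move=> TT; elim: s => [|x s IH] /=; first exact: trmx1.
by rewrite trmx_mul IH TT rev_cons foldr_rcons mulmx1 [RHS]foldr_mulmx.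
Qed.

Lemma trmx_ratio_value n (b SL SR PL PR : 'M[F]_n) : SR \in unitmx ->
  SL *m PL = PR *m SR -> b *m SR = PL -> b^T *m SL^T = PR^T.
Proof.
move=> uS e bS; rewrite -trmx_mul; congr trmx; apply: (can_inj (mulmxK uS)).
by rewrite -mulmxA bS.
Qed.

Lemma trmx_mul3 n (A A' B B' D D' : 'M[F]_n) : A^T = A' -> B^T = B' -> D^T = D' ->
  (A *m B *m D)^T = D' *m B' *m A'.
Proof. by move=> <- <- <-; rewrite !trmx_mul mulmxA. Qed.

End Assembly.

Section Transposition.
Variables (R : realType) (d : nat).
Local Notation C := (C R).
Local Notation Md := 'M[C]_d.+1.

(** Transposition exchanges the off-diagonal blocks, and by hypothesis transposing the parameter
    exchanges them back. *)
Lemma Theta_tr N i (a : Md) : rhoL a^T = (rhoR a)^T -> rhoR a^T = (rhoL a)^T ->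
  (Theta N i a^T)^T = Theta N i a.
Proof.
move=> eL eR; rewrite /Theta tr_blk; apply: eq_blk => r s _ _.
rewrite eL eR adj_tr.
rewrite (andbC (s == i) (r == i)) (andbC (s == i) (r == i.+1)) (andbC (s == i.+1) (r == i)).
rewrite (andbC (s == i.+1) (r == i.+1)) (eq_sym s r).
have n1 : (i == i.+1) = false by rewrite ltn_eqF.
case: (eqVneq r i) => [->|ri] /=.
  by rewrite n1 /=; case: (s == i); case: (s == i.+1); rewrite ?trmxK //;
    case: (i == s); rewrite ?trmx1 ?trmx0.
case: (r == i.+1) => /=; last by case: (r == s); rewrite ?trmx1 ?trmx0.
by case: (s == i); case: (s == i.+1); rewrite ?trmxK ?linearN /= ?trmxK //;
    case: (r == s); rewrite ?trmx1 ?trmx0.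
Qed.

Lemma Hess_tr N (a : nat -> Md) :
  (forall i, rhoL (a i)^T = (rhoR (a i))^T) -> (forall i, rhoR (a i)^T = (rhoL (a i))^T) ->
  (Hess N (fun i => (a i)^T))^T = Hesshat N a.
Proof.
by move=> eL eR; apply: trmx_foldr_mulmx => i; exact: Theta_tr.
Qed.

Lemma blkdiag_tr N i (X : Md) : (blkdiag N i X^T)^T = blkdiag N i X.
Proof.
rewrite /blkdiag tr_blk; apply: eq_blk => r s _ _.
have [->|rs] := eqVneq r s; last by rewrite trmx0.
by case: ifP => _; rewrite ?trmxK ?trmx1.
Qed.

End Transposition.

Section Dual.
Variables (R : realType) (d : nat).
Local Notation C := (C R).
Local Notation Md := 'M[C]_d.+1.
Variable mu : {measure set R -> \bar R}.
Variables (W : R -> Md) (phiL phiR : nat -> {poly Md}).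
Hypothesis HW : is_matrix_measure mu W.
Hypothesis HL : is_ONP_L mu W phiL.
Hypothesis HR : is_ONP_R mu W phiR.
Local Notation alpha := (szego_coef mu W phiL phiR).
Variables j k : nat.
Hypothesis Hjk : (j <= k)%N.
Local Notation N := (k - j)%N.
Variable z : C.
Hypothesis z1 : `|z| < 1.
Variables fk bj : Md.
Hypothesis Hf : fk *m wip mu (tcauchy z) W (star k (phiL k)) 1 = wip mu (cauchy z) W (phiR k) 1.
Hypothesis Hb : bj *m ev (star j (phiR j)) z = ev (phiL j) z.

Lemma schur_fun_PhiL :
  schur_fun mu (fun t => PhiL phiL j k t *m W t *m adj (PhiL phiL j k t)) z =
  blkdiag N 0 bj *m adj (Hesshat N (fun i => alpha (j + i)%N)) *m blkdiag N N fk.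
Proof.
pose Wt t := (W t)^T; pose psiL i := trp (phiR i); pose psiR i := trp (phiL i).
have HWt : is_matrix_measure mu Wt := is_matrix_measure_tr HW.
have HLt : is_ONP_L mu Wt psiL := is_ONP_L_tr HR.
have HRt : is_ONP_R mu Wt psiR := is_ONP_R_tr HL.
have Hft := schur_value_dual HW HL HR z1 Hf.
have uS : ev (star j (phiR j)) z \in unitmx.
  have [_] := wtau_starL_unit HWt HLt z1 j.
  by rewrite /psiL star_trp ev_trp unitmx_tr.
have Hbt : bj^T *m ev (star j (psiR j)) z = ev (psiL j) z.
  rewrite /psiR /psiL star_trp !ev_trp.
  exact: trmx_ratio_value uS (ev_onp_comm HW HL HR z j) Hb.
have main := schur_fun_PhiR HWt HLt HRt Hjk z1 Hft Hbt.
have HV := PhiR_matrix_measure HWt HRt j k.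
(* The left compression is the transpose of the right compression built from the transposed measure
   and polynomials. *)
have -> : (fun t => PhiL phiL j k t *m W t *m adj (PhiL phiL j k t)) =
    (fun t => (adj (PhiR psiR j k t) *m Wt t *m PhiR psiR j k t)^T).
  apply/funext => t.
  have -> : PhiL phiL j k t = (PhiR psiR j k t)^T.
    apply/matrixP => p c; rewrite !mxE.
    have e : mpoly_at (psiR (j + p %/ d.+1)%N) t = (mpoly_at (phiL (j + p %/ d.+1)%N) t)^T.
      exact: ev_trp.
    by rewrite e mxE.
  by rewrite !trmx_mul trmxK adj_tr mulmxA.
have eA : (fun i => szego_coef mu Wt psiL psiR (j + i)%N) = (fun i => (alpha (j + i)%N)^T).
  by apply/funext => i; exact: szego_coef_trE HL HR _.
rewrite eA in main.
have eH : (adj (Hess N (fun i => (alpha (j + i)%N)^T)))^T =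
    adj (Hesshat N (fun i => alpha (j + i)%N)).
  apply: etrans (esym (adj_tr _)) (congr1 (@adj R _ _) _).
  by apply: Hess_tr => i; [exact: rhoL_tr|exact: rhoR_tr].
apply: etrans (schur_fun_tr HV z1) (etrans (congr1 trmx main) _).
exact: trmx_mul3 (blkdiag_tr N N fk) eH (blkdiag_tr N 0 bj).
Qed.

End Dual.

Theorem theorem6p1 (R : realType) (d : nat)
  (mu : {measure set R -> \bar R}) (W : R -> 'M[C R]_d.+1)
  (Hmu : is_matrix_measure mu W) (Hnt : nontrivial mu W)
  (phiL phiR : nat -> {poly 'M[C R]_d.+1})
  (HphiL : is_ONP_L mu W phiL) (HphiR : is_ONP_R mu W phiR)
  (b : nat -> C R -> 'M[C R]_d.+1)
  (Hb : forall i, is_schur (b i) /\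
          has_fin_schur_params (b i)
            (rcons [seq - adj (schur_iter (schur_fun mu W) m 0) | m <- rev (iota 0 i)]
                   1%:M))
  (j k : nat) (Hjk : (j <= k)%N) (z : C R) (Hz : `|z| < 1) :
  let f := schur_fun mu W in
  let alpha := fun m => schur_iter f m 0 in
  let fk := schur_iter f k in
  let N := (k - j)%N in
  schur_fun mu (fun t => adj (PhiR phiR j k t) *m W t *m PhiR phiR j k t) z
    = blk N.+1 (fun r s => if r == s then (if r == N then fk z else 1%:M) else 0)
      *m adj (Hess N (fun i => alpha (j + i)%N))
      *m blk N.+1 (fun r s => if r == s then (if r == 0%N then b j z else 1%:M) else 0)
  /\
  schur_fun mu (fun t => PhiL phiL j k t *m W t *m adj (PhiL phiL j k t)) z
    = blk N.+1 (fun r s => if r == s then (if r == 0%N then b j z else 1%:M) else 0)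
      *m adj (Hesshat N (fun i => alpha (j + i)%N))
      *m blk N.+1 (fun r s => if r == s then (if r == N then fk z else 1%:M) else 0).
Proof.
move=> f alpha fk N.
have Ef : fk z *m wip mu (tcauchy z) W (star k (phiL k)) 1 = wip mu (cauchy z) W (phiR k) 1.
  exact: (schur_iter_szego Hmu HphiL HphiR k).
have Eb : b j z *m ev (star j (phiR j)) z = ev (phiL j) z.
  have [[bD _] [b0 b1]] := Hb j.
  apply: (inverse_iterate Hmu HphiL HphiR _ _ bD Hz).
    (* Entry m of the reversed list is -alpha_{j-m-1}^dag, and the terminal 1 sits at index j. *)
    move=> m mj; rewrite b0; last by rewrite size_rcons size_map size_rev size_iota ltnS ltnW.
    rewrite nth_rcons size_map size_rev size_iota mj.
    rewrite (nth_map 0%N) ?size_rev ?size_iota // nth_rev ?size_iota //.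
    rewrite nth_iota ?ltn_subrL // ?add0n; last by rewrite (leq_trans _ mj).
    by rewrite (schur_iter_alpha Hmu HphiL HphiR).
  move=> w w1; have := b1 w w1.
  by rewrite size_rcons size_map size_rev size_iota.
have Ea : (fun i => alpha (j + i)%N) = (fun i => szego_coef mu W phiL phiR (j + i)%N).
  by apply/funext => i; exact: schur_iter_alpha.
rewrite Ea; split.
  (* [blkdiag] unfolds to the outer factors of the statement, so the result applies by
     conversion. *)
  have h := schur_fun_PhiR Hmu HphiL HphiR Hjk Hz Ef Eb.
  exact: h.
have h := schur_fun_PhiL Hmu HphiL HphiR Hjk Hz Ef Eb.
exact: h.
Qed.
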